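(* Let $K$ be an imaginary quadratic field, $f_\rho$ a positive integer, $\underline{\mathfrak c}=f_\rho\sqrt{D_K}\mathcal O_K$, and let $\varphi$ be a Hecke character of $K$ of infinity type $[-1/2;1,0]$ whose conductor $\mathfrak c_f$ divides $\underline{\mathfrak c}$. Then the Hecke theta function $\vartheta(\tau;\varphi)$ can be written as a linear combination of the functions $f_a(\tau;\beta)$ ($a=1,\dots,h$, $\beta\in G_{\Lambda_a}$) in which the coefficient of $f_a(\tau;\beta)$ is zero unless $\beta\in\mathrm{orb}^a_{\mathfrak q}$ for some integral ideal $\mathfrak q$ with $\mathfrak q\mid\underline{\mathfrak c}$ and $\mathfrak q+\mathfrak c_f=\mathcal O_K$ (equivalently, $\mathfrak q$ divides $\mathfrak q_{p.\mathfrak c_f}:=\prod_{i:\mathfrak p_i\nmid\mathfrak c_f}\mathfrak p_i^{n_i}$, where $\underline{\mathfrak c}=\prod_i\mathfrak p_i^{n_i}$ is the prime factorization).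
   Context: Embed $K\subset\mathbb C$ with $\sqrt{D_K}$ in the upper half plane $\mathcal H$; $D_K<0$ the discriminant, $h$ the class number. Hecke character of infinity type $[-1/2;1,0]$ with conductor $\mathfrak c_f$: a homomorphism $\varphi$ from fractional ideals prime to $\mathfrak c_f$ to $\mathbb C^\times$ with $\varphi(\alpha\mathcal O_K)=\alpha\chi'_\varphi(\alpha)$ for $\alpha\in\mathcal O_K$ prime to $\mathfrak c_f$, $\chi'_\varphi$ a character of $(\mathcal O_K/\mathfrak c_f)^\times$, $\mathfrak c_f$ minimal. $\vartheta(\tau;\varphi)=\sum_I\varphi(I)e^{2\pi i\tau\mathrm{Nm}(I)}$ over nonzero integral ideals ($\varphi(I)=0$ if $I$ not prime to $\mathfrak c_f$). Let $z_1,\dots,z_h\in\mathcal H$ represent the $\mathbb C$-isomorphism classes of elliptic curves with CM by $\mathcal O_K$, $\mathfrak b_{z_a}=\mathbb Z+z_a\mathbb Z$; for $z=z_a$ let $(a_z,b_z,c_z)$ coprime integers, $a_z>0$, $a_zz^2+b_zz+c_z=0$. $\Lambda_a$: lattice with basis $e_2,e_1$, Gram matrix $f_\rho\begin{pmatrix}2a_z&b_z\\ b_z&2c_z\end{pmatrix}$; $G_{\Lambda_a}=\Lambda_a^\vee/\Lambda_a$; $\Omega'_a$: $\mathbb Q$-linear map with $\Omega'_a(e_2)=\sqrt{2a_zf_\rho}$, $\Omega'_a(e_1)=-\sqrt{2a_zf_\rho}z$; $\Omega_a=i\sqrt{|G_{\Lambda_a}|}(2a_zf_\rho)^{-1/2}\Omega'_a$,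 which satisfies $\Omega_a(\Lambda_a^\vee)=\mathfrak b_{z_a}$, $\Omega_a(\Lambda_a)=\underline{\mathfrak c}\mathfrak b_{z_a}$. $f_a(\tau;\beta)=\sum_{y\in\Lambda_a^\vee,\,y+\Lambda_a=\beta}\Omega'_a(y)e^{\pi if_\rho|D_K|\tau(y,y)}$. For an integral ideal $\mathfrak q\mid\underline{\mathfrak c}$, $\mathrm{orb}^a_{\mathfrak q}$ is the set of $\beta\in G_{\Lambda_a}$ such that the annihilator $\{\alpha\in\mathcal O_K:\alpha\,\Omega_a(\beta)\in\underline{\mathfrak c}\mathfrak b_{z_a}\}$ of $\Omega_a(\beta)\in\mathfrak b_{z_a}/\underline{\mathfrak c}\mathfrak b_{z_a}$ equals $\underline{\mathfrak c}\mathfrak q^{-1}$. *)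

(* Defs.v *)
From HB Require Import structures.
From mathcomp Require Import all_boot all_order all_algebra.
From mathcomp Require Import all_classical all_reals all_analysis.
From mathcomp Require Import complex.
Import Order.TTheory GRing.Theory Num.Theory.
Import numFieldNormedType.Exports.



Unset Printing Implicit Defensive.

Local Open Scope ring_scope.
Local Open Scope classical_set_scope.

Definition iC (R : realType) : R[i] := Complex 0 1.
Definition rC (R : realType) (x : R) : R[i] := Complex x 0.

Definition cexp (R : realType) (w : R[i]) : R[i] :=
  Complex (expR (complex.Re w) * cos (complex.Im w)) (expR (complex.Re w) * sin (complex.Im w)).

Definition climn (R : realType) (u : nat -> R[i]) : R[i] :=
  limn (u : nat -> (R[i])^o).

Definition squarefree_int (m : int) : Prop :=
  forall p : nat, prime p -> ~~ ((p ^ 2)%N %| `|m|)%N.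

Definition fund_disc (D : int) : Prop :=
  ((D %% 4)%Z = 1 /\ squarefree_int D) \/
  (exists m : int, D = 4 * m /\ ((m %% 4)%Z = 2 \/ (m %% 4)%Z = 3)
                   /\ squarefree_int m).

Definition sqrtD (R : realType) (D : int) : R[i] :=
  Complex 0 (Num.sqrt ((- D)%:~R)).

Definition omegaK (R : realType) (D : int) : R[i] :=
  (D%:~R + sqrtD R D) / 2%:R.

Definition Kset (R : realType) (D : int) : set R[i] :=
  [set x | exists r s : rat, x = ratr r + ratr s * sqrtD R D].

Definition OK (R : realType) (D : int) : set R[i] :=
  [set x | exists m n : int, x = m%:~R + n%:~R * omegaK R D].

Definition OK_module (R : realType) (D : int) (I : set R[i]) : Prop :=
  I 0 /\ (forall x y, I x -> I y -> I (x - y)) /\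
  (forall a x, OK R D a -> I x -> I (a * x)).

Definition integral_ideal (R : realType) (D : int) (I : set R[i]) : Prop :=
  I `<=` OK R D /\ OK_module R D I /\ (exists x, I x /\ x != 0).

Definition frac_ideal (R : realType) (D : int) (I : set R[i]) : Prop :=
  I `<=` Kset R D /\ OK_module R D I /\ (exists x, I x /\ x != 0) /\
  (exists d : int, d != 0 /\ forall x, I x -> OK R D (d%:~R * x)).

Definition imul (R : realType) (I J : set R[i]) : set R[i] :=
  [set x | exists s : seq (R[i] * R[i]),
      (forall p, p \in s -> I p.1 /\ J p.2) /\
      x = \sum_(p <- s) p.1 * p.2].

Definition iadd (R : realType) (I J : set R[i]) : set R[i] :=
  [set x | exists a b, I a /\ J b /\ x = a + b].

Definition iinv (R : realType) (D : int) (I : set R[i]) : set R[i] :=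
  [set x | Kset R D x /\ forall y, I y -> OK R D (x * y)].

Definition principal (R : realType) (D : int) (a : R[i]) : set R[i] :=
  [set x | exists y, OK R D y /\ x = a * y].

Definition coprime_id (R : realType) (D : int) (I J : set R[i]) : Prop :=
  iadd R I J = OK R D.

Definition idvd (R : realType) (D : int) (Q C : set R[i]) : Prop :=
  exists M, integral_ideal R D M /\ C = imul R Q M.

Definition frac_prime_to (R : realType) (D : int) (cf I : set R[i]) : Prop :=
  frac_ideal R D I /\
  exists J1 J2, integral_ideal R D J1 /\ integral_ideal R D J2 /\
    coprime_id R D J1 cf /\ coprime_id R D J2 cf /\
    I = imul R J1 (iinv R D J2).

(* norm of an integral ideal: the index [O_K : I], computed as |det| of a
   Z-basis of I written in the Z-basis (1, omega) of O_K *)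
Definition ideal_norm_is (R : realType) (D : int) (I : set R[i]) (n : nat)
  : Prop :=
  exists u v : R[i], I u /\ I v /\
    (forall x, I x <-> exists m k : int, x = m%:~R * u + k%:~R * v) /\
    exists a1 b1 a2 b2 : int,
      u = a1%:~R + b1%:~R * omegaK R D /\ v = a2%:~R + b2%:~R * omegaK R D /\
      `|a1 * b2 - a2 * b1| = n%:Z.

(* chi is a character of (O_K / m)^x (given on representatives in O_K) *)
Definition char_mod (R : realType) (D : int) (m : set R[i]) (chi : R[i] -> R[i])
  : Prop :=
  forall a b, OK R D a -> OK R D b ->
    coprime_id R D (principal R D a) m -> coprime_id R D (principal R D b) m ->
    (m (a - b) -> chi a = chi b) /\ chi (a * b) = chi a * chi b /\ chi a != 0.

Definition infty_type_mod (R : realType) (D : int) (cf m : set R[i])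
  (phi : set R[i] -> R[i]) : Prop :=
  exists chi, char_mod R D m chi /\
    forall a, OK R D a -> coprime_id R D (principal R D a) cf ->
      phi (principal R D a) = a * chi a.

Definition hecke_char (R : realType) (D : int) (cf : set R[i])
  (phi : set R[i] -> R[i]) : Prop :=
  integral_ideal R D cf /\
  (forall I J, frac_prime_to R D cf I -> frac_prime_to R D cf J ->
     phi (imul R I J) = phi I * phi J) /\
  (forall I, frac_prime_to R D cf I -> phi I != 0) /\
  infty_type_mod R D cf cf phi /\
  (* minimality of the conductor cf *)
  (forall c', integral_ideal R D c' -> cf `<=` c' ->
     infty_type_mod R D cf c' phi -> c' = cf).

(* the Hecke theta function
   theta(tau; phi) = sum_I phi(I) e^{2 pi i tau Nm(I)},
   summed by increasing norm (phi(I) := 0 if I not prime to cf) *)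
Definition theta_coef (R : realType) (D : int) (cf : set R[i])
  (phi : set R[i] -> R[i]) (n : nat) : R[i] :=
  (\sum_(I \in [set I | integral_ideal R D I /\ ideal_norm_is R D I n])
     (if `[< coprime_id R D I cf >] then phi I else 0))%R.

Definition theta_ps (R : realType) (D : int) (cf : set R[i])
  (phi : set R[i] -> R[i]) (tau : R[i]) (M : nat) : R[i] :=
  \sum_(1 <= n < M.+1)
     theta_coef R D cf phi n * cexp R (2%:R * rC R pi * iC R * tau * n%:R).

Definition theta (R : realType) (D : int) (cf : set R[i])
  (phi : set R[i] -> R[i]) (tau : R[i]) : R[i] :=
  climn R (theta_ps R D cf phi tau).

Definition lattice (R : realType) (z : R[i]) : set R[i] :=
  [set x | exists m n : int, x = m%:~R + n%:~R * z].

Definition cm_by_OK (R : realType) (D : int) (z : R[i]) : Prop :=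
  [set a | forall x, lattice R z x -> lattice R z (a * x)] = OK R D.

Definition homothetic (R : realType) (L1 L2 : set R[i]) : Prop :=
  exists l : R[i], l != 0 /\ L2 = [set l * x | x in L1].

Definition cbar (R : realType) (D : int) (f : nat) : set R[i] :=
  principal R D (f%:R * sqrtD R D).

(* For z with (A,B,C), Lambda = Z e2 + Z e1 with Gram matrix
   f [[2A, B], [B, 2C]].  Vectors are written by coordinates (x2, x1) in
   the basis (e2, e1).  Lambda^dual lies in (1/N) Z^2 with N = det(Gram),
   so the elements of G_Lambda = Lambda^dual / Lambda are represented
   uniquely by y = (p/N, q/N) with 0 <= p, q < N and y in Lambda^dual. *)
Definition gramN (f : nat) (A B C : int) : nat :=
  (f ^ 2 * absz (B ^+ 2 - 4%:Z * A * C)%R)%N.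

(* (p/N, q/N) in Lambda^dual, i.e. its pairing with e2 and e1 is integral *)
Definition in_dual (f : nat) (A B C : int) (p q : nat) : bool :=
  ((gramN f A B C)%:Z %| f%:Z * (2%:Z * A * p%:Z + B * q%:Z))%Z &&
  ((gramN f A B C)%:Z %| f%:Z * (B * p%:Z + 2%:Z * C * q%:Z))%Z.

Definition cardG (f : nat) (A B C : int) : nat :=
  #|[set pq : 'I_(gramN f A B C) * 'I_(gramN f A B C) |
       in_dual f A B C pq.1 pq.2]|.

Definition gram_qf (R : realType) (f : nat) (A B C : int) (x2 x1 : R) : R :=
  f%:R * (2%:R * A%:~R * x2 ^+ 2 + 2%:R * B%:~R * x2 * x1
          + 2%:R * C%:~R * x1 ^+ 2).

Definition Omega' (R : realType) (f : nat) (A : int) (z : R[i]) (x2 x1 : R)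
  : R[i] :=
  rC R (Num.sqrt (2%:R * A%:~R * f%:R)) * (rC R x2 - rC R x1 * z).

Definition Omega (R : realType) (f : nat) (A B C : int) (z : R[i])
  (x2 x1 : R) : R[i] :=
  iC R * rC R (Num.sqrt (cardG f A B C)%:R)
       * rC R (Num.sqrt (2%:R * A%:~R * f%:R))^-1 * Omega' R f A z x2 x1.

(* partial sums of f_a(tau; beta) over y = beta + lambda, lambda in
   Lambda = Z^2, |coordinates of lambda| <= M *)
Definition fa_ps (R : realType) (D : int) (f : nat) (A B C : int) (z : R[i])
  (p q : nat) (tau : R[i]) (M : nat) : R[i] :=
  let N := gramN f A B C in
  \sum_(i < (2 * M).+1) \sum_(j < (2 * M).+1)
    let x2 : R := p%:R / N%:R + (i%:Z - M%:Z)%:~R in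
    let x1 : R := q%:R / N%:R + (j%:Z - M%:Z)%:~R in
    Omega' R f A z x2 x1 *
      cexp R (rC R pi * iC R * (f%:R * (- D)%:~R) * tau
            * rC R (gram_qf R f A B C x2 x1)).

Definition fa (R : realType) (D : int) (f : nat) (A B C : int) (z : R[i])
  (p q : nat) (tau : R[i]) : R[i] :=
  climn R (fa_ps R D f A B C z p q tau).

(* beta = (p/N, q/N) lies in orb^a_Q : the annihilator of
   Omega_a(beta) in b_z / cbar b_z equals cbar Q^{-1} *)
Definition in_orb (R : realType) (D : int) (f : nat) (A B C : int)
  (z : R[i]) (p q : nat) (Q : set R[i]) : Prop :=
  let N := gramN f A B C in
  [set a | OK R D a /\
     imul R (cbar R D f) (lattice R z)
       (a * Omega R f A B C z (p%:R / N%:R) (q%:R / N%:R))]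
  = imul R (cbar R D f) (iinv R D Q).

(* Main.v *)
(** For [z] with [a z^2 + b z + c = 0] of discriminant [D], the lattice
[b_z = Z + z Z] is an invertible [O_K]-module with inverse
[Z a + Z (a z + b)], and every integral ideal is [I(w) = w b_z^-1] for exactly
one class representative [z] and for some [w] in [b_z], unique up to the
finitely many units of [O_K]; moreover [Nm I(w) = a |w|^2].  The map [Omega]
identifies the dual lattice with [b_z] and turns the exponent of [f_a] into
[2 pi i tau Nm I(w)], so that theta is the sum over all classes and all [w] of
[phi(I(w)) e^(2 pi i tau Nm I(w))], divided by the number of units.

It remains to see that [phi(I(w)) / w] only depends on [w] modulo
[f sqrt(D) b_z], which gives the coefficients: if [t = w s] lies in [I(w)] and
is 1 modulo [cf], then [J = s b_z] satisfies [I(w) J = (t)] and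
[I(w') J = (t w' / w)] with [t w' / w] again 1 modulo [cf], and [phi] maps both
principal ideals to their generators.  The coefficient vanishes unless [I(w)] is
prime to [cf], and then [w] lies in the orbit of [Q = I(w) + (f sqrt D)].

The two sides sum the same absolutely convergent family, ordered by norm and by
boxes respectively. *)

Require Import Defs.
From HB Require Import structures.
From mathcomp Require Import all_boot all_order all_algebra.
From mathcomp Require Import all_classical all_reals all_analysis.
From mathcomp Require Import complex.
From mathcomp Require Import ring lra zify.
Import Order.TTheory GRing.Theory Num.Theory.
Import numFieldNormedType.Exports.
Set Implicit Arguments.
Unset Strict Implicit.
Unset Printing Implicit Defensive.
Local Open Scope ring_scope.
Local Open Scope classical_set_scope.

(** * Lattices with complex multiplication *)

Section Complex.
Variable R : realType.
Implicit Types (x y z : R[i]) (m n : int).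

(** Invertibility of ideals is carried by explicit generators. Products of generators of [b_z] and
    of its inverse lattice include [A], [A z], [A z + B] and [- C], so primitivity of the form
    writes 1 as a sum of products; cancellation, double duality and the step from containment to
    divisibility all follow from this one relation. The inverse lattice is [A] times the conjugate
    of [b_z], whence the conjugations in the search for a class representative of an ideal. That
    search succeeds only if the multiplier ring of the ideal is all of [O_K], and there the
    squarefreeness in [fund_disc] enters. Division by [w] is legitimate because -1 and 1 generate
    the same ideal: the infinity type then excludes the conductor [O_K], so an ideal prime to [cf]
    never comes from [w = 0]. For a fixed class, the terms of all [f_a(tau; beta)] are extended by
    zero to one index set, the pairs [(l, k)] with [w = l + k z]. There the partial sums of theta
    are exact finite combinations of partial sums ordered by norm, and convergence only has to
    replace this order by boxes, for each [f_a] separately. *)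

Lemma cReD x y : complex.Re (x + y) = complex.Re x + complex.Re y.
Proof. by case: x; case: y. Qed.

Lemma cImD x y : complex.Im (x + y) = complex.Im x + complex.Im y.
Proof. by case: x; case: y. Qed.

Lemma cReM x y : complex.Re (x * y) =
  complex.Re x * complex.Re y - complex.Im x * complex.Im y.
Proof. by case: x; case: y. Qed.

Lemma cImM x y : complex.Im (x * y) =
  complex.Re x * complex.Im y + complex.Im x * complex.Re y.
Proof. by case: x => a b; case: y => c d /=. Qed.

Lemma Re_intr m : complex.Re (m%:~R : R[i]) = m%:~R.
Proof. by rewrite -(rmorph_int (real_complex R)). Qed.

Lemma Im_intr m : complex.Im (m%:~R : R[i]) = 0.
Proof. by rewrite -(rmorph_int (real_complex R)). Qed.

Lemma Im_linear m n z : complex.Im (m%:~R + n%:~R * z) = n%:~R * complex.Im z.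
Proof. by rewrite cImD cImM Im_intr Re_intr Im_intr mul0r addr0 add0r. Qed.

Lemma Re_linear m n z :
  complex.Re (m%:~R + n%:~R * z) = m%:~R + n%:~R * complex.Re z.
Proof. by rewrite cReD cReM Im_intr !Re_intr mul0r subr0. Qed.

Lemma lattice_coord_inj z l k l' k' : 0 < complex.Im z ->
  l%:~R + k%:~R * z = l'%:~R + k'%:~R * z -> l = l' :> int /\ k = k' :> int.
Proof.
move=> z0 e.
have /(congr1 (@complex.Im _)) := e; rewrite !Im_linear.
move/(mulIf (lt0r_neq0 z0))/intr_inj => ek; split=> //.
by move: e; rewrite ek => /addIr/intr_inj.
Qed.

Lemma sqr_sqrtD (D : int) : D < 0 -> sqrtD R D ^+ 2 = D%:~R.
Proof.
move=> D0; rewrite expr2 /sqrtD -(rmorph_int (real_complex R)).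
have d0 : 0 <= ((- D)%:~R : R) by rewrite ler0z oppr_ge0 ltW.
apply/eqP; rewrite eq_complex /=; apply/andP; split; apply/eqP.
  by rewrite mul0r sub0r -expr2 sqr_sqrtr // rmorphN opprK.
by rewrite mul0r mulr0 addr0.
Qed.

Lemma omegaK2 (D : int) : 2 * omegaK R D = D%:~R + sqrtD R D.
Proof. by rewrite /omegaK; field. Qed.

Lemma Im_sqrtD_gt0 (D : int) : D < 0 -> 0 < complex.Im (sqrtD R D).
Proof. by move=> D0; rewrite /= sqrtr_gt0 ltr0z oppr_gt0. Qed.

Lemma sqrtD_neq0 (D : int) : D < 0 -> sqrtD R D != 0.
Proof. by move=> /Im_sqrtD_gt0 h; apply: contraTneq h => ->; rewrite ltxx. Qed.

Lemma Im_omegaK (D : int) : 2 * complex.Im (omegaK R D) = complex.Im (sqrtD R D).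
Proof.
have := congr1 (@complex.Im _) (omegaK2 D).
rewrite cImD Im_intr add0r => <-.
by rewrite -[2 : R[i]]/(2%:~R) cImM Im_intr Re_intr mul0r addr0.
Qed.

Lemma Im_omegaK_gt0 (D : int) : D < 0 -> 0 < complex.Im (omegaK R D).
Proof. by move=> /Im_sqrtD_gt0; rewrite -Im_omegaK pmulr_rgt0. Qed.

End Complex.

(** The last clause fixes the sign of the square root, hence selects the root in the upper half
    plane; together with the discriminant it implies the quadratic equation. *)
Definition cm_form (R : realType) (D : int) (z : R[i]) (A B C : int) : Prop :=
  [/\ 0 < A, B ^+ 2 - 4 * A * C = D, gcdz (gcdz A B) C = 1 &
      2 * A%:~R * z + B%:~R = sqrtD R D].

Lemma bezout3 (a b c : int) : gcdz (gcdz a b) c = 1 ->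
  exists x y t : int, x * a + y * b + t * c = 1.
Proof.
move=> g1; have [u [v e1]] := Bezoutz a b; have [s [t e]] := Bezoutz (gcdz a b) c.
move: e; rewrite g1 -e1 => e; exists (s * u), (s * v), t; rewrite -e; ring.
Qed.

Section Form.
Variables (R : realType) (D : int).
Hypothesis D0 : D < 0.

(** The multiplier ring of [Z + Z z] contains [A z], and comparison with [Z + Z omega] shows that
    [A z] and [omega] have the same imaginary part. This pins down the discriminant of the form. *)
Lemma cm_form_intro (z : R[i]) (A B C : int) :
  0 < complex.Im z -> cm_by_OK R D z -> 0 < A ->
  gcdz (gcdz A B) C = 1 -> A%:~R * z ^+ 2 + B%:~R * z + C%:~R = 0 ->
  cm_form D z A B C.
Proof.
move=> z0 cmz A0 g1 eqz.
have AC0 : (A%:~R : R[i]) != 0 by rewrite intr_eq0 gt_eqF.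
have OKAz : OK R D (A%:~R * z).
  rewrite -cmz => _ [l [k ->]]; exists (- k * C), (l * A - k * B).
  apply/eqP; rewrite -subr_eq0; apply/eqP.
  transitivity (k%:~R * (A%:~R * z ^+ 2 + B%:~R * z + C%:~R)); first by ring.
  by rewrite eqz mulr0.
have OKw : OK R D (omegaK R D) by exists 0, 1; rewrite mulr0z mulr1z mul1r add0r.
move: (OKw); rewrite -{1}cmz => mw.
have [l [k]] : lattice R z (omegaK R D * 1).
  by apply: mw; exists 1, 0; rewrite mulr0z mul0r addr0.
rewrite mulr1 => ew.
have [l' [k']] : lattice R z (omegaK R D * z).
  by apply: mw; exists 0, 1; rewrite mulr0z mul1r add0r.
rewrite ew => e2.
have [ekC ekB] : - (k * C) = A * l' /\ A * l - k * B = A * k'.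
  apply: (@lattice_coord_inj R z) => //.
  transitivity (A%:~R * ((l%:~R + k%:~R * z) * z)); last by rewrite e2; ring.
  apply/eqP; rewrite -subr_eq0; apply/eqP.
  transitivity (- k%:~R * (A%:~R * z ^+ 2 + B%:~R * z + C%:~R)); first by ring.
  by rewrite eqz mulr0.
have [x [y [t xyt]]] := bezout3 g1.
(* [A] divides [k A], [k B] and [k C], by the two relations just found, hence [k], because the form
   is primitive. *)
have ek : k = A * (x * k + y * (l - k') - t * l').
  rewrite -{1}[k]mul1r -xyt.
  have -> : (x * A + y * B + t * C) * k =
     x * A * k - y * (A * l - k * B) + y * A * l - t * (- (k * C)) by ring.
  by rewrite ekC ekB; ring.
set k2 := (x * k + y * (l - k') - t * l') in ek.
have [m [n eA]] := OKAz.
have IA : complex.Im (A%:~R * z) = A%:~R * complex.Im z.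
  by rewrite -[A%:~R * z]add0r -[0]/((0:int)%:~R : R[i]) Im_linear.
have Iw : complex.Im (omegaK R D) = k2%:~R * (A%:~R * complex.Im z).
  by rewrite ew Im_linear ek; ring.
have IAw : A%:~R * complex.Im z = n%:~R * complex.Im (omegaK R D).
  by rewrite -IA eA Im_linear.
have w0 := Im_omegaK_gt0 R D0.
have Az0 : 0 < A%:~R * complex.Im z by rewrite mulr_gt0 ?ltr0z.
(* The imaginary parts of [omega] and [A z] are integral multiples of each other, by [k2] and by
   [n]. *)
have nk : k2 * n = 1.
  apply: (@intr_inj R); apply: (mulIf (lt0r_neq0 w0)).
  by rewrite mulr1z mul1r {2}Iw IAw; ring.
have n0 : 0 < n by move: Az0; rewrite IAw pmulr_lgt0 // ltr0z.
have n1 : n = 1.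
  have k20 : 0 < k2 by rewrite -(pmulr_lgt0 _ n0) nk.
  by clear -nk n0 k20; nia.
have Rz0 : (2 * A%:~R * z + B%:~R) ^+ 2 = (B ^+ 2 - 4 * A * C)%:~R.
  transitivity (4 * A%:~R * (A%:~R * z ^+ 2 + B%:~R * z + C%:~R) +
    (B ^+ 2 - 4 * A * C)%:~R); first by ring.
  by rewrite eqz mulr0 add0r.
have e2A : 2 * A%:~R * z + B%:~R = B%:~R + (2 * A)%:~R * z by ring.
have Is : complex.Im (2 * A%:~R * z + B%:~R) = complex.Im (sqrtD R D).
  by rewrite -Im_omegaK e2A Im_linear intrM -mulrA IAw n1 mulr1z mul1r.
(* The square of [2 A z + B] is an integer, so twice the product of its real and imaginary parts
   vanishes. *)
have Rs : complex.Re (2 * A%:~R * z + B%:~R) = 0.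
  have := congr1 (@complex.Im _) Rz0; rewrite Im_intr expr2 cImM Is.
  move/eqP; rewrite [X in _ + X]mulrC -mulr2n mulrn_eq0 /= mulf_eq0.
  by rewrite [X in _ || X]gt_eqF ?Im_sqrtD_gt0 // orbF => /eqP.
have es : 2 * A%:~R * z + B%:~R = sqrtD R D.
  by apply/eqP; rewrite eq_complex Is Rs /= !eqxx.
split=> //; apply: (@intr_inj R[i]); rewrite -Rz0 es sqr_sqrtD //.
Qed.

End Form.

(** Since [A z + B] is minus the conjugate of [A z], this is [A] times the complex conjugate of
    [lattice R z]. *)
Definition inv_lattice (R : realType) (z : R[i]) (A B : int) : set R[i] :=
  [set s | exists m n : int, s = m%:~R * A%:~R + n%:~R * (A%:~R * z + B%:~R)].

Definition lattice_ideal (R : realType) (z : R[i]) (A B : int) (w : R[i]) :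
  set R[i] := [set w * s | s in inv_lattice z A B].

(** The value of [A |l + k z|^2]; the signs come from [2 A Re z = - B] and [A |z|^2 = C]. *)
Definition norm_form (A B C l k : int) : int :=
  A * l ^+ 2 - B * l * k + C * k ^+ 2.

Lemma fund_disc_omega (D : int) : fund_disc D -> exists C : int, 4 * C = D ^+ 2 - D.
Proof.
case=> [[D1 _]|[m [-> _]]].
  rewrite (divz_eq D 4) D1; set q := (D %/ 4)%Z.
  by exists (q * (4 * q + 1)); ring.
by exists (m * (4 * m - 1)); ring.
Qed.

Section FormTheory.
Variables (R : realType) (D : int).
Hypothesis D0 : D < 0.

(** The principal form. [lattice R (omegaK R D)] is [OK R D] by definition, so every result on
    lattices with a form also applies to the ring of integers. *)
Lemma cm_form_omega : fund_disc D ->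
  exists C, cm_form D (omegaK R D) 1 (- D) C.
Proof.
move=> /fund_disc_omega[C eC]; exists C; split=> //.
- by rewrite mulr1 eC; ring.
- by rewrite gcd1z gcd1z.
- by rewrite mulr1 omegaK2; ring.
Qed.

Section OneForm.
Variables (z : R[i]) (A B C : int).
Hypothesis F : cm_form D z A B C.

Lemma cm_form_Agt0 : 0 < A. Proof. by case: F. Qed.

Lemma cm_form_Aneq0 : (A%:~R : R[i]) != 0.
Proof. by rewrite intr_eq0 gt_eqF ?cm_form_Agt0. Qed.

Lemma cm_form_disc : D = B ^+ 2 - 4 * A * C. Proof. by case: F. Qed.

Lemma cm_form_sqrtD : sqrtD R D = 2 * A%:~R * z + B%:~R. Proof. by case: F. Qed.

Lemma cm_form_root : A%:~R * z ^+ 2 + B%:~R * z + C%:~R = 0.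
Proof.
have := sqr_sqrtD R D0; rewrite cm_form_sqrtD cm_form_disc => e.
have A0 := cm_form_Aneq0.
apply: (@mulfI _ (4 * A%:~R)); first by rewrite mulf_neq0 ?pnatr_eq0.
rewrite mulr0; apply/eqP; rewrite -(subrr (B ^+ 2 - 4 * A * C)%:~R) -{1}e.
by apply/eqP; ring.
Qed.

Lemma cm_form_sqr : A%:~R * z ^+ 2 = - B%:~R * z - C%:~R.
Proof.
apply/eqP; rewrite -subr_eq0; apply/eqP; rewrite -cm_form_root; ring.
Qed.

Lemma cm_form_AIm : A%:~R * complex.Im z = complex.Im (omegaK R D).
Proof.
have := Im_omegaK R D; rewrite cm_form_sqrtD.
have -> : 2 * A%:~R * z + B%:~R = B%:~R + (2 * A)%:~R * z by ring.
by rewrite Im_linear intrM -mulrA => /mulfI ->//; rewrite pnatr_eq0.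
Qed.

Lemma cm_form_Im_gt0 : 0 < complex.Im z.
Proof.
have := Im_omegaK_gt0 R D0; rewrite -cm_form_AIm pmulr_rgt0 // ltr0z.
exact: cm_form_Agt0.
Qed.

(** [D] and [B] have the same parity because [D = B^2 - 4 A C]; the integer is [(D + B) / 2]. *)
Lemma omegaK_form : exists e : int, omegaK R D = e%:~R + A%:~R * z.
Proof.
have [e ee] : exists e : int, 2 * e = D + B.
  have [q [eB|eB]] : exists q : int, B = 2 * q \/ B = 2 * q + 1.
  - by exists (B %/ 2)%Z; lia.
  - by exists (2 * q ^+ 2 - 2 * A * C + q); rewrite cm_form_disc eB; ring.
  - by exists (2 * q ^+ 2 + 3 * q + 1 - 2 * A * C); rewrite cm_form_disc eB; ring.
exists e; apply: (@mulfI _ 2); first by rewrite pnatr_eq0.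
rewrite omegaK2 cm_form_sqrtD mulrDr.
by rewrite -[2 * e%:~R](intrM _ 2 e) ee; ring.
Qed.

Lemma OK_formP x : OK R D x <-> exists m n : int, x = m%:~R + n%:~R * (A%:~R * z).
Proof.
have [e ee] := omegaK_form; split=> -[m [n ->]].
  by exists (m + n * e), n; rewrite ee; ring.
by exists (m - n * e), n; rewrite ee; ring.
Qed.

Lemma lattice_OK a x : OK R D a -> lattice R z x -> lattice R z (a * x).
Proof.
move=> /OK_formP[m [n ->]] [l [k ->]].
exists (m * l - n * k * C), (m * k + n * l * A - n * k * B).
transitivity (m%:~R * l%:~R + m%:~R * k%:~R * z + n%:~R * l%:~R * A%:~R * z
  + n%:~R * k%:~R * (A%:~R * z ^+ 2)); first by ring.
by rewrite cm_form_sqr; ring.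
Qed.

Lemma inv_lattice_OK a x :
  OK R D a -> inv_lattice z A B x -> inv_lattice z A B (a * x).
Proof.
move=> /OK_formP[m [n ->]] [l [k ->]].
exists (m * l - n * l * B - n * k * C), (m * k + n * l * A).
transitivity (m%:~R * l%:~R * A%:~R + m%:~R * k%:~R * (A%:~R * z + B%:~R) +
  n%:~R * l%:~R * A%:~R * A%:~R * z + n%:~R * k%:~R * A%:~R * (A%:~R * z ^+ 2)
  + n%:~R * k%:~R * A%:~R * B%:~R * z); first by ring.
by rewrite cm_form_sqr; ring.
Qed.

Lemma inv_lattice_mul s y : inv_lattice z A B s -> lattice R z y -> OK R D (s * y).
Proof.
move=> [m [n ->]] [l [k ->]]; apply/OK_formP.
exists (m * l * A + n * l * B - n * k * C), (m * k + n * l).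
transitivity (m%:~R * A%:~R * (l%:~R + k%:~R * z) +
  n%:~R * l%:~R * (A%:~R * z + B%:~R) + n%:~R * k%:~R * (A%:~R * z ^+ 2)
  + n%:~R * k%:~R * B%:~R * z); first by ring.
by rewrite cm_form_sqr; ring.
Qed.


(** This is the invertibility of the lattice. Products of generators give [A], then
    [(A z + B) - A z = B] and [(A z + B) z = - C], and a Bezout relation for the primitive form
    combines them to 1. *)
Lemma inv_lattice_dual : exists s1 s2 y1 y2,
  [/\ inv_lattice z A B s1 & inv_lattice z A B s2] /\
  [/\ lattice R z y1, lattice R z y2 & s1 * y1 + s2 * y2 = 1].
Proof.
have [_ _ /bezout3[x [y [t e]]] _] := F.
exists A%:~R, (A%:~R * z + B%:~R), (x%:~R - y%:~R * z), (y%:~R - t%:~R * z).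
split; split.
- by exists 1, 0; ring.
- by exists 0, 1; ring.
- by exists x, (- y); ring.
- by exists y, (- t); ring.
transitivity ((x * A + y * B)%:~R - t%:~R * (A%:~R * z ^+ 2)
   - t%:~R * B%:~R * z); first by ring.
rewrite cm_form_sqr; transitivity ((x * A + y * B + t * C)%:~R : R[i]).
  by ring.
by rewrite e.
Qed.

Lemma lattice_add x y : lattice R z x -> lattice R z y -> lattice R z (x + y).
Proof. by move=> [m [n ->]] [l [k ->]]; exists (m + l), (n + k); ring. Qed.

Lemma lattice_sub x y : lattice R z x -> lattice R z y -> lattice R z (x - y).
Proof. by move=> [m [n ->]] [l [k ->]]; exists (m - l), (n - k); ring. Qed.

Lemma lattice1 : lattice R z 1.
Proof. by exists 1, 0; ring. Qed.

(** Double duality: multiplying [y] by the relation [s1 y1 + s2 y2 = 1] turns it into an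
    [O_K]-combination of lattice points. *)
Lemma lattice_dualP y :
  (forall s, inv_lattice z A B s -> OK R D (y * s)) -> lattice R z y.
Proof.
move=> h; have [s1 [s2 [y1 [y2 [[i1 i2] [l1 l2 e]]]]]] := inv_lattice_dual.
have -> : y = y * s1 * y1 + y * s2 * y2 by rewrite -[y in LHS]mulr1 -e; ring.
by apply: lattice_add; apply: lattice_OK => //; apply: h.
Qed.

Lemma sqr_norm_form (l k : int) :
  (norm_form A B C l k)%:~R =
  A%:~R * (complex.Re (l%:~R + k%:~R * z) ^+ 2 +
           complex.Im (l%:~R + k%:~R * z) ^+ 2) :> R.
Proof.
rewrite Im_linear Re_linear.
have A0 : (A%:~R : R) != 0 by rewrite intr_eq0 gt_eqF ?cm_form_Agt0.
have eR : 2 * A%:~R * complex.Re z = - B%:~R :> R.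
  have := congr1 (@complex.Re _) cm_form_sqrtD.
  have -> : 2 * A%:~R * z + B%:~R = B%:~R + (2 * A)%:~R * z by ring.
  rewrite Re_linear /= intrM => /eqP; rewrite eq_sym addrC addr_eq0 => /eqP.
  by [].
have eI : A%:~R * (complex.Re z ^+ 2 + complex.Im z ^+ 2) = C%:~R :> R.
  have := congr1 (@complex.Re _) cm_form_root.
  have -> : A%:~R * z ^+ 2 + B%:~R * z + C%:~R =
     C%:~R + 1%:~R * (B%:~R * z + A%:~R * z ^+ 2) by ring.
  rewrite Re_linear mulr1z mul1r cReD expr2 !cReM !Re_intr !Im_intr !mul0r !subr0 /=.
  have -> : (B%:~R : R) = - (2 * A%:~R * complex.Re z) by rewrite eR opprK.
  by move=> e; apply/eqP; rewrite -subr_eq0 -[X in _ == X]oppr0 -e; apply/eqP; ring.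
transitivity (A%:~R * l%:~R ^+ 2 - B%:~R * l%:~R * k%:~R + C%:~R * k%:~R ^+ 2 : R).
  by rewrite /norm_form; ring.
have -> : (B%:~R : R) = - (2 * A%:~R * complex.Re z) by rewrite eR opprK.
rewrite -eI; ring.
Qed.

End OneForm.
End FormTheory.

(** * Ideals *)

Section Ideals.
Variables (R : realType) (D : int).
Hypotheses (D0 : D < 0) (Df : fund_disc D).
Implicit Types (I J L : set R[i]) (x y a : R[i]).

Lemma OK_int (m : int) : OK R D m%:~R.
Proof. by exists m, 0; ring. Qed.

Lemma OK_1 : OK R D 1.
Proof. by exists 1, 0; ring. Qed.

Lemma OK_add x y : OK R D x -> OK R D y -> OK R D (x + y).
Proof. exact: lattice_add. Qed.

Lemma OK_sub x y : OK R D x -> OK R D y -> OK R D (x - y).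
Proof. exact: lattice_sub. Qed.

Lemma OK_mul x y : OK R D x -> OK R D y -> OK R D (x * y).
Proof. have [C F] := cm_form_omega R Df; exact: (lattice_OK D0 F). Qed.

Lemma OK_OK_module : OK_module R D (OK R D).
Proof.
split; first exact: (OK_int 0).
by split=> x y; [apply: OK_sub|apply: OK_mul].
Qed.

Lemma OK_Kset x : OK R D x -> Kset R D x.
Proof.
move=> [m [n ->]]; exists (m%:~R + n%:~R * D%:~R / 2), (n%:~R / 2).
by rewrite rmorphD !rmorphM !fmorphV !rmorph_int rmorph_nat /omegaK; field.
Qed.

Lemma OK_module_opp I x : OK_module R D I -> I x -> I (- x).
Proof. by move=> [i0 [iB _]] ix; rewrite -sub0r; apply: iB. Qed.

Lemma OK_module_add I x y : OK_module R D I -> I x -> I y -> I (x + y).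
Proof.
by move=> iI ix iy; rewrite -[y]opprK; apply: iI.2.1 => //; apply: OK_module_opp.
Qed.

Lemma OK_module_int I x (m : int) : OK_module R D I -> I x -> I (m%:~R * x).
Proof. by move=> iI ix; apply: iI.2.2 => //; apply: OK_int. Qed.

Lemma imul_mem I J x y : I x -> J y -> imul R I J (x * y).
Proof.
move=> ix jy; exists [:: (x, y)]; split; last by rewrite big_seq1.
by move=> p; rewrite inE => /eqP ->.
Qed.

Lemma imul_add I J x y : imul R I J x -> imul R I J y -> imul R I J (x + y).
Proof.
move=> [s [hs ->]] [t [ht ->]]; exists (s ++ t); split; last by rewrite big_cat.
by move=> p; rewrite mem_cat => /orP[/hs|/ht].
Qed.

Lemma imul_sub I J L : OK_module R D L ->
  (forall x y, I x -> J y -> L (x * y)) -> imul R I J `<=` L.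
Proof.
move=> mL hL _ [s [hs ->]]; rewrite big_seq.
apply: (big_ind L); first exact: mL.1.
  by move=> x y; apply: OK_module_add.
by move=> p /hs[]; apply: hL.
Qed.

Lemma scaled_OK_module a I : OK_module R D I ->
  OK_module R D [set a * y | y in I].
Proof.
move=> mI; split; first by exists 0; [exact: mI.1|rewrite mulr0].
split=> [_ _ [x ix <-] [y iy <-]|u _ uO [x ix <-]].
  by exists (x - y); [apply: mI.2.1|rewrite mulrBr].
by exists (u * x); [apply: mI.2.2|rewrite mulrCA].
Qed.

Lemma principalE a : principal R D a = [set a * y | y in OK R D].
Proof. by apply/seteqP; split=> [x [y [yO ->]]|x [y yO <-]]; exists y. Qed.

Lemma principal_OK_module a : OK_module R D (principal R D a).
Proof. by rewrite principalE; apply: scaled_OK_module; apply: OK_OK_module. Qed.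

Lemma principal_id a : principal R D a a.
Proof. by exists 1; rewrite mulr1; split=> //; apply: OK_1. Qed.

Lemma imul_principal a L : OK_module R D L ->
  imul R (principal R D a) L = [set a * y | y in L].
Proof.
move=> mL; apply/seteqP; split=> [|_ [y ly <-]].
  apply: imul_sub; first exact: scaled_OK_module.
  move=> _ y [u [uO ->]] ly; exists (u * y); last by rewrite mulrA.
  exact: mL.2.2.
by apply: imul_mem => //; apply: principal_id.
Qed.

Lemma imul_OKr I : OK_module R D I -> imul R I (OK R D) = I.
Proof.
move=> mI; apply/seteqP; split=> [|x ix].
  by apply: imul_sub => // x y ix yO; rewrite mulrC; apply: mI.2.2.
by rewrite -[x]mulr1; apply: imul_mem => //; apply: OK_1.
Qed.

Lemma iinv_OK : Defs.iinv R D (OK R D) = OK R D.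
Proof.
apply/seteqP; split=> x; first by move=> [_ /(_ _ OK_1)]; rewrite mulr1.
by move=> xO; split=> [|y]; [apply: OK_Kset|apply: OK_mul].
Qed.

Lemma integral_OK : integral_ideal R D (OK R D).
Proof.
split=> //; split; first exact: OK_OK_module.
by exists 1; split; [exact: OK_1|exact: oner_neq0].
Qed.

Lemma coprime_idP I J : I `<=` OK R D -> J `<=` OK R D ->
  OK_module R D I -> OK_module R D J ->
  coprime_id R D I J <-> exists i j, [/\ I i, J j & i + j = 1].
Proof.
move=> sI sJ mI mJ; split=> [IJ|[i [j [ii jj e]]]].
  have : iadd R I J 1 by rewrite IJ; exact: OK_1.
  by move=> [i [j [ii [jj e]]]]; exists i, j.
apply/seteqP; split=> x; first by move=> [a [b [ia [jb ->]]]]; apply: OK_add; auto.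
move=> xO; exists (x * i), (x * j).
by split; [apply: mI.2.2|split; [apply: mJ.2.2|rewrite -mulrDr e mulr1]].
Qed.

Lemma integral_frac_prime_to cf I : integral_ideal R D cf ->
  integral_ideal R D I -> coprime_id R D I cf -> frac_prime_to R D cf I.
Proof.
move=> icf [sI [mI neI]] cI; split.
  split; first by move=> x /sI; apply: OK_Kset.
  split=> //; split=> //; exists 1; split=> // x /sI.
  by rewrite mulr1z mul1r.
exists I, (OK R D); split=> //; split; first exact: integral_OK.
split=> //; split; last by rewrite iinv_OK imul_OKr.
have [sc [mc _]] := icf.
apply/coprime_idP => //; first exact: OK_OK_module.
by exists 1, 0; rewrite addr0; split=> //; [apply: OK_1|apply: mc.1].
Qed.

Section OneForm.
Variables (z : R[i]) (A B C : int).
Hypothesis F : cm_form D z A B C.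

Lemma lattice_OK_module : OK_module R D (lattice R z).
Proof.
split; first by exists 0, 0; ring.
by split=> x y; [apply: lattice_sub|apply: (lattice_OK D0 F)].
Qed.

Lemma inv_lattice_OK_module : OK_module R D (inv_lattice z A B).
Proof.
split; first by exists 0, 0; ring.
split=> x y; last exact: (inv_lattice_OK D0 F).
by move=> [m [n ->]] [l [k ->]]; exists (m - l), (n - k); ring.
Qed.

Lemma lattice_ideal_OK_module w : OK_module R D (lattice_ideal z A B w).
Proof. exact/scaled_OK_module/inv_lattice_OK_module. Qed.

Lemma lattice_ideal_sub w : lattice R z w -> lattice_ideal z A B w `<=` OK R D.
Proof. by move=> lw _ [s si <-]; rewrite mulrC; apply: (inv_lattice_mul D0 F). Qed.

Lemma inv_lattice_A : inv_lattice z A B A%:~R.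
Proof. by exists 1, 0; ring. Qed.

Lemma lattice_ideal_integral w : lattice R z w -> w != 0 ->
  integral_ideal R D (lattice_ideal z A B w).
Proof.
move=> lw w0; split; first exact: lattice_ideal_sub.
split; first exact: lattice_ideal_OK_module.
exists (w * A%:~R); split; first by exists A%:~R => //; exact: inv_lattice_A.
by rewrite mulf_neq0 // (cm_form_Aneq0 F).
Qed.

Lemma lattice_ideal_mem w : lattice R z w ->
  (forall s, inv_lattice z A B s -> OK R D (w * s)).
Proof. by move=> lw s si; rewrite mulrC; apply: (inv_lattice_mul D0 F). Qed.

Lemma cofactor_sub u : inv_lattice z A B u -> [set u * y | y in lattice R z] `<=` OK R D.
Proof. by move=> iu _ [y ly <-]; apply: (inv_lattice_mul D0 F). Qed.

Lemma cofactor_integral u : inv_lattice z A B u -> u != 0 ->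
  integral_ideal R D [set u * y | y in lattice R z].
Proof.
move=> iu u0; split; first exact: cofactor_sub.
split; first exact/scaled_OK_module/lattice_OK_module.
exists u; split=> //; exists 1; rewrite ?mulr1 //; exact: lattice1.
Qed.

(** The lattice cancels against its inverse. This supplies, for any ideal of the form [w b_z^-1], an
    explicit complementary factor with principal product. *)
Lemma imul_cofactor w u :
  imul R (lattice_ideal z A B w) [set u * y | y in lattice R z] =
  principal R D (w * u).
Proof.
apply/seteqP; split.
  apply: imul_sub; first exact: principal_OK_module.
  move=> _ _ [s si <-] [y ly <-]; exists (s * y).
  by split; [apply: (inv_lattice_mul D0 F)|rewrite mulrACA].
move=> _ [x [xO ->]].
have [s1 [s2 [y1 [y2 [[i1 i2] [l1 l2 e]]]]]] := inv_lattice_dual D0 F.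
have -> : w * u * x = (w * s1) * (u * (x * y1)) + (w * s2) * (u * (x * y2)).
  by rewrite -[LHS]mulr1 -e; ring.
by apply: imul_add; apply: imul_mem; [exists s1|exists (x * y1)
  |exists s2|exists (x * y2)] => //; apply: (lattice_OK D0 F).
Qed.

End OneForm.

(** Inverting both sides of [w b_z^-1 = w' b_z'^-1]; each inclusion is an instance of double
    duality. *)
Lemma lattice_ideal_homothetic z A B C z' A' B' C' w w' :
  cm_form D z A B C -> cm_form D z' A' B' C' -> w != 0 -> w' != 0 ->
  lattice_ideal z A B w = lattice_ideal z' A' B' w' ->
  lattice R z' = [set w' / w * x | x in lattice R z].
Proof.
move=> F F' w0 w0' e; apply/seteqP; split=> [y ly|_ [x lx <-]].
  exists (w / w' * y); last by field; rewrite w0 w0'.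
  apply: (lattice_dualP D0 F) => s si.
  have : lattice_ideal z A B w (w * s) by exists s.
  rewrite e => -[s' si' es].
  have -> : w / w' * y * s = s' * y.
    apply: (mulfI w0'); transitivity (w * s * y); first by field.
    by rewrite -es; ring.
  exact: (inv_lattice_mul D0 F').
apply: (lattice_dualP D0 F') => s' si'.
have : lattice_ideal z' A' B' w' (w' * s') by exists s'.
rewrite -e => -[s si es].
have -> : w' / w * x * s' = s * x.
  apply: (mulfI w0); transitivity (w' * s' * x); first by field.
  by rewrite -es; ring.
exact: (inv_lattice_mul D0 F).
Qed.

Lemma lattice_ideal_unit z A B C w u :
  cm_form D z A B C -> OK R D u -> OK R D u^-1 -> u != 0 ->
  lattice_ideal z A B (w * u) = lattice_ideal z A B w.
Proof.
move=> F uO vO u0; apply/seteqP; split=> _ [s si <-].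
  by exists (u * s); [apply: (inv_lattice_OK D0 F)|rewrite mulrA].
by exists (u^-1 * s); [apply: (inv_lattice_OK D0 F)|field].
Qed.

End Ideals.

(** * Norms of ideals *)

Section Norm.
Variables (R : realType) (D : int).
Hypotheses (D0 : D < 0) (Df : fund_disc D).
Implicit Types (I J L : set R[i]) (x y u v : R[i]).

(** Signed area of the parallelogram on [x] and [y]. A change of basis multiplies it by the
    determinant and multiplication by [w] by [|w|^2], which is how indices are compared. *)
Definition area (x y : R[i]) : R :=
  complex.Re x * complex.Im y - complex.Im x * complex.Re y.

Lemma area_linear u v (m k m' k' : int) :
  area (m%:~R * u + k%:~R * v) (m'%:~R * u + k'%:~R * v) =
  (m * k' - k * m')%:~R * area u v.
Proof. by rewrite /area !cReD !cImD !cReM !cImM !Im_intr !Re_intr; ring. Qed.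

Lemma area_OK (a1 b1 a2 b2 : int) :
  area (a1%:~R + b1%:~R * omegaK R D) (a2%:~R + b2%:~R * omegaK R D) =
  (a1 * b2 - a2 * b1)%:~R * complex.Im (omegaK R D).
Proof. by rewrite /area !Re_linear !Im_linear; ring. Qed.

Lemma area_mul w x y :
  area (w * x) (w * y) = (complex.Re w ^+ 2 + complex.Im w ^+ 2) * area x y.
Proof. by rewrite /area !cReM !cImM; ring. Qed.

Lemma ideal_norm_area I n : ideal_norm_is R D I n ->
  exists u v, [/\ I u, I v,
    forall x, I x <-> exists m k : int, x = m%:~R * u + k%:~R * v &
    `|area u v| = n%:R * complex.Im (omegaK R D)].
Proof.
move=> [u [v [iu [iv [b [a1 [b1 [a2 [b2 [eu [ev e]]]]]]]]]]]; exists u, v; split=> //.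
rewrite eu ev area_OK normrM [`|complex.Im _|]gtr0_norm ?Im_omegaK_gt0 //.
by rewrite -intr_norm e.
Qed.

Lemma ideal_norm_unique I n n' :
  ideal_norm_is R D I n -> ideal_norm_is R D I n' -> n = n'.
Proof.
move=> /ideal_norm_area[u [v [iu iv b e]]] /ideal_norm_area[u' [v' [iu' iv' b' e']]].
have [m [k eu]] := (b _).1 iu'; have [m' [k' ev]] := (b _).1 iv'.
have [l [j eu']] := (b' _).1 iu; have [l' [j' ev']] := (b' _).1 iv.
have e1 : area u' v' = (m * k' - k * m')%:~R * area u v by rewrite eu ev area_linear.
have e2 : area u v = (l * j' - j * l')%:~R * area u' v'.
  by rewrite {1}eu' {1}ev' area_linear.
have w0 := Im_omegaK_gt0 R D0.
suff : `|area u v| = `|area u' v'|.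
  by rewrite e e' => /(mulIf (lt0r_neq0 w0))/eqP; rewrite eqr_nat => /eqP.
(* The generators are not assumed independent; if one area vanishes, so does the other. Otherwise
   the two transition determinants are mutually inverse integers. *)
have [a0|a0] := eqVneq (area u v) 0; first by rewrite e1 a0 mulr0.
set d := m * k' - k * m' in e1; set d' := l * j' - j * l' in e2.
have dd : d' * d = 1.
  apply: (@intr_inj R); apply: (mulIf a0).
  by rewrite mulr1z mul1r {2}e2 e1; ring.
have d1 : `|d| = 1.
  have /eqP := congr1 absz dd; rewrite abszM muln_eq1 => /andP[_ /eqP].
  by rewrite -abszE => ->.
by rewrite e1 normrM -intr_norm d1 mul1r.
Qed.

(** The basis [w A], [w (A z + B)] spans the area [|w|^2 A (A Im z)], and [A Im z = Im omega] is the
    area of [O_K]; the index is therefore [A |w|^2]. *)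
Lemma lattice_ideal_norm (z : R[i]) (A B C : int) (l k : int) (n : nat) :
  cm_form D z A B C ->
  (ideal_norm_is R D (lattice_ideal z A B (l%:~R + k%:~R * z)) n <->
   norm_form A B C l k = n%:Z).
Proof.
move=> F; set w := l%:~R + k%:~R * z.
have lw : lattice R z w by exists l, k.
(* One implication is enough: the form takes a natural value, which is then a norm, and norms are
   unique. *)
suff H : forall n', norm_form A B C l k = n'%:Z ->
    ideal_norm_is R D (lattice_ideal z A B w) n'.
  split=> [h|]; last exact: H.
  have N0 : 0 <= norm_form A B C l k.
    rewrite -(ler0z R) (sqr_norm_form D0 F) mulr_ge0 ?addr_ge0 ?sqr_ge0 //.
    by rewrite ler0z ltW // (cm_form_Agt0 F).
  case: (norm_form A B C l k) N0 H => // n' _ H.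
  by congr Posz; apply: ideal_norm_unique h; apply: H.
move=> n' en.
have iu : lattice_ideal z A B w (w * A%:~R).
  by exists A%:~R => //; apply: inv_lattice_A.
have iv : lattice_ideal z A B w (w * (A%:~R * z + B%:~R)).
  by exists (A%:~R * z + B%:~R) => //; exists 0, 1; ring.
have [a1 [b1 e1]] := lattice_ideal_sub D0 F lw iu.
have [a2 [b2 e2]] := lattice_ideal_sub D0 F lw iv.
exists (w * A%:~R), (w * (A%:~R * z + B%:~R)); split=> //; split=> //; split.
  move=> x; split=> [[_ [m [j ->]] <-]|[m [j ->]]].
    by exists m, j; ring.
  by exists (m%:~R * A%:~R + j%:~R * (A%:~R * z + B%:~R)); [exists m, j|ring].
exists a1, b1, a2, b2; split=> //; split=> //.
have w0 := Im_omegaK_gt0 R D0.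
suff -> : a1 * b2 - a2 * b1 = n'%:Z by [].
apply: (@intr_inj R); apply: (mulIf (lt0r_neq0 w0)).
rewrite -area_OK -e1 -e2 area_mul -en (sqr_norm_form D0 F) -/w.
rewrite -(cm_form_AIm F).
have -> : area A%:~R (A%:~R * z + B%:~R) = A%:~R * (A%:~R * complex.Im z).
  by rewrite /area cReD cImD cReM cImM !Im_intr !Re_intr; ring.
ring.
Qed.

(** Hermite normal form: [c] is the least positive integer in the ideal and [g] the least positive
    [omega]-coordinate; division with remainder shows that they generate. *)
Lemma integral_ideal_basis I : integral_ideal R D I ->
  exists (c : nat) (m : int) (g : nat), [/\ (0 < c)%N, (0 < g)%N &
  forall x, I x <-> exists s t : int,
    x = s%:~R * c%:R + t%:~R * (m%:~R + g%:R * omegaK R D)].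
Proof.
move=> [sI [mI [x0 [ix0 x00]]]].
have [Cw Fw] := cm_form_omega R Df.
have [a [b ex0]] := sI _ ix0.
pose nn := norm_form 1 (- D) Cw a b.
(* The first factor is the conjugate of [x0], as [omega] has trace [D]. So the norm of [x0] is a
   positive integer in the ideal, and both minima below exist. *)
have enn : nn%:~R = (a%:~R + b%:~R * (D%:~R - omegaK R D)) * x0.
  rewrite /nn /norm_form ex0.
  transitivity (a%:~R ^+ 2 + D%:~R * a%:~R * b%:~R - b%:~R ^+ 2 *
    (1%:~R * omegaK R D ^+ 2 - D%:~R * omegaK R D)).
    by rewrite (cm_form_sqr D0 Fw); ring.
  ring.
have nn0 : 0 < nn.
  rewrite -(ltr0z R) (sqr_norm_form D0 Fw) -ex0 mul1r.
  rewrite lt_def addr_ge0 ?sqr_ge0 // andbT.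
  apply: contra_neq x00 => /eqP.
  rewrite paddr_eq0 ?sqr_ge0 // !sqrf_eq0 => h.
  by apply/eqP; rewrite eq_complex.
have inn : I nn%:~R.
  rewrite enn; apply: mI.2.2 => //; exists (a + b * D), (- b); ring.
have exc : exists c : nat, `[< (0 < c)%N /\ I c%:R >].
  exists `|nn|%N; apply/asboolP; split; first by rewrite absz_gt0 gt_eqF.
  by rewrite pmulrn gtz0_abs.
have exg : exists g : nat, `[< (0 < g)%N /\ exists m : int,
    I (m%:~R + g%:R * omegaK R D) >].
  exists `|nn|%N; apply/asboolP; split; first by rewrite absz_gt0 gt_eqF.
  exists 0; rewrite pmulrn gtz0_abs // add0r mulrC; apply: mI.2.2 => //.
  by exists 0, 1; ring.
have [c /asboolP[c0 ic] minc] := ex_minnP exc.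
have [g /asboolP[g0 [m ig]] ming] := ex_minnP exg.
exists c, m, g; split=> // x; split; last first.
  move=> [s [t ->]]; apply: (OK_module_add mI); exact: (OK_module_int _ mI).
move=> ix; have [a' [b' ex]] := sI _ ix.
pose q := (b' %/ g)%Z.
have ir : I ((a' - q * m)%:~R + (b' %% g)%Z%:~R * omegaK R D).
  have -> : (a' - q * m)%:~R + (b' %% g)%Z%:~R * omegaK R D =
     x - q%:~R * (m%:~R + g%:R * omegaK R D).
    by rewrite ex {2}(divz_eq b' g) -/q; ring.
  by apply: mI.2.1 => //; apply: (OK_module_int _ mI).
have r0 : (b' %% g)%Z = 0.
  have [h1 h2] : 0 <= (b' %% g)%Z /\ (b' %% g)%Z < g%:Z.
    by rewrite modz_ge0 ?ltz_pmod // -lt0n.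
  case: (b' %% g)%Z h1 h2 ir => // -[//|r] _; rewrite ltz_nat => rg ir.
  suff : (g <= r.+1)%N by rewrite leqNgt rg.
  by apply: ming; apply/asboolP; split=> //; exists (a' - q * m).
move: ir; rewrite r0 mul0r addr0 => ir.
pose q' := ((a' - q * m) %/ c)%Z.
have ir' : I ((a' - q * m) %% c)%Z%:~R.
  have -> : ((a' - q * m) %% c)%Z%:~R = (a' - q * m)%:~R - q'%:~R * c%:R :> R[i].
    by rewrite {2}(divz_eq (a' - q * m) c) -/q'; ring.
  by apply: mI.2.1 => //; apply: (OK_module_int _ mI).
have r0' : ((a' - q * m) %% c)%Z = 0.
  have [h1 h2] : 0 <= ((a' - q * m) %% c)%Z /\ ((a' - q * m) %% c)%Z < c%:Z.
    by rewrite modz_ge0 ?ltz_pmod // -lt0n.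
  case: ((a' - q * m) %% c)%Z h1 h2 ir' => // -[//|r] _; rewrite ltz_nat => rg ir'.
  suff : (c <= r.+1)%N by rewrite leqNgt rg.
  by apply: minc; apply/asboolP; split.
exists q', q.
have ea : a' = q' * c + q * m.
  by apply/eqP; rewrite -subr_eq; apply/eqP; rewrite {1}(divz_eq (a' - q * m) c) r0' addr0.
have eb : b' = q * g by rewrite {1}(divz_eq b' g) r0 addr0.
by rewrite ex ea eb; ring.
Qed.

End Norm.

(** After division by the gcd of [n] and [k], the square of the reduced [n] is prime to that of the
    reduced [k], so it divides the squarefree [m] and is 1. *)
Lemma squarefree_sqr_dvd (m n k x : int) : squarefree_int m -> n != 0 ->
  n ^+ 2 * x = k ^+ 2 * m -> (n %| k)%Z.
Proof.
move=> sf n0 e.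
have d2 : (`|n| ^ 2 %| `|k| ^ 2 * `|m|)%N.
  by apply/dvdnP; exists `|x|%N; rewrite -!abszX -!abszM -e mulrC.
rewrite dvdzE; move: d2; have: (0 < `|n|)%N by rewrite absz_gt0.
move: {e n0 x} `|n|%N `|k|%N => {}n {}k n0 d2.
have g0 : (0 < gcdn n k)%N by rewrite gcdn_gt0 n0.
have [n' en] := dvdnP (dvdn_gcdl n k); have [k' ek] := dvdnP (dvdn_gcdr n k).
have co : coprime n' k'.
  by rewrite /coprime -(eqn_pmul2r g0) mul1n muln_gcdl -en -ek.
have d3 : (n' ^ 2 %| `|m|)%N.
  have {d2} : ((n' * gcdn n k) ^ 2 %| (k' * gcdn n k) ^ 2 * `|m|)%N by rewrite -en -ek.
  rewrite !expnMn mulnAC dvdn_pmul2r ?expn_gt0 ?g0 //.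
  by rewrite Gauss_dvdr // coprimeXl // coprimeXr.
have n'1 : n' = 1%N.
  have [//|n1] := eqVneq n' 1%N.
  have /sf : prime (pdiv n').
    apply: pdiv_prime; rewrite ltn_neqAle eq_sym n1.
    by move: n0; rewrite en muln_gt0 => /andP[].
  by rewrite (dvdn_trans _ d3) // dvdn_exp2r // pdiv_dvd.
have <- : gcdn n k = n by rewrite [RHS]en n'1 mul1n.
exact: dvdn_gcdr.
Qed.

(** * Ideal classes *)

Lemma intz_parity (x : int) : exists s, x = 2 * s \/ x = 2 * s + 1.
Proof. by exists (x %/ 2)%Z; lia. Qed.

Section Classes.
Variables (R : realType) (D : int).
Hypotheses (D0 : D < 0) (Df : fund_disc D).

(** Arithmetic core of integral closedness: for an element of trace [T] and norm [N] with
    [omega]-coordinate [k / n], it yields the integral coordinates [x + t omega]. Here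
    squarefreeness is used. *)
Lemma fund_disc_integral (n k T N : int) : n != 0 ->
  n ^+ 2 * (T ^+ 2 - 4 * N) = k ^+ 2 * D ->
  exists t x : int, k = n * t /\ T = 2 * x + t * D.
Proof.
(* Wrong parities of [T] and [t] are refuted modulo 4, by exhibiting a multiple of 4 equal to 1, 2
   or 3. *)
have no4 (x y : int) : y = 1 \/ y = 2 \/ y = 3 -> 4 * x = y -> False by clear; lia.
move=> n0 e; case: Df => [[D1 sf]|[m [eD [m4 sf]]]].
  have /dvdzP[t et] := squarefree_sqr_dvd sf n0 e.
  have e' : T ^+ 2 - 4 * N = t ^+ 2 * D.
    apply: (mulfI (expf_neq0 2 n0)); rewrite e et; ring.
  have [q eD] : exists q, D = 4 * q + 1.
    by exists (D %/ 4)%Z; rewrite {1}(divz_eq D 4) D1 mulrC.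
  have [s [eT|eT]] := intz_parity T; have [r [er|er]] := intz_parity t.
  - exists t, (s - r * D); rewrite et mulrC; split=> //; rewrite er eT; ring.
  - exfalso; apply: (no4 (s ^+ 2 - N - q * (2 * r + 1) ^+ 2 - r ^+ 2 - r) 1); auto.
    transitivity (1 + (T ^+ 2 - 4 * N) - t ^+ 2 * D); first by rewrite eT er eD; ring.
    by rewrite e' addrK.
  - exfalso; apply: (no4 (N + r ^+ 2 * D - s ^+ 2 - s) 1); auto.
    transitivity (1 - (T ^+ 2 - 4 * N) + t ^+ 2 * D); first by rewrite eT er; ring.
    by rewrite e' subrK.
  - exists t, (s - r * D - 2 * q); rewrite et mulrC; split=> //; rewrite er eT eD; ring.
(* For [D = 4 m] the squarefree number is [m], so a factor 2 moves into [k]. As [m] is 2 or 3 modulo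
   4, both [T] and [t] must be even. *)
have e4 : n ^+ 2 * (T ^+ 2 - 4 * N) = (2 * k) ^+ 2 * m by rewrite e eD; ring.
have /dvdzP[t et] := squarefree_sqr_dvd sf n0 e4.
have e' : T ^+ 2 - 4 * N = t ^+ 2 * m.
  apply: (mulfI (expf_neq0 2 n0)); rewrite e4 et; ring.
have [q [j [ej em]]] : exists q j : int, (j = 2 \/ j = 3) /\ m = 4 * q + j.
  by exists (m %/ 4)%Z, (m %% 4)%Z; split=> //; rewrite mulrC -divz_eq.
have [s [eT|eT]] := intz_parity T; have [r [er|er]] := intz_parity t.
- exists r, (s - 2 * r * m); split; last by rewrite eT eD; ring.
  by apply: (@mulfI _ (2 : int)) => //; rewrite et er; ring.
- exfalso; apply: (no4 (s ^+ 2 - N - q - (r ^+ 2 + r) * m) j).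
    by case: ej; auto.
  transitivity (j + (T ^+ 2 - 4 * N) - t ^+ 2 * m); first by rewrite eT er em; ring.
  by rewrite e' addrK.
- exfalso; apply: (no4 (N + r ^+ 2 * m - s ^+ 2 - s) 1); auto.
  transitivity (1 - (T ^+ 2 - 4 * N) + t ^+ 2 * m); first by rewrite eT er; ring.
  by rewrite e' subrK.
- exfalso; apply: (no4 (s ^+ 2 + s - N - q - (r ^+ 2 + r) * m) (j - 1)).
    by case: ej => ->; auto.
  transitivity (j - 1 + (T ^+ 2 - 4 * N) - t ^+ 2 * m).
    by rewrite eT er em; ring.
  by rewrite e' addrK.
Qed.

Lemma OK_integral (n m k T N : int) (a : R[i]) : n != 0 ->
  n%:~R * a = m%:~R + k%:~R * omegaK R D -> complex.Im a != 0 ->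
  a ^+ 2 - T%:~R * a + N%:~R = 0 -> OK R D a.
Proof.
move=> n0 ena a0 eq2.
have n0R : (n%:~R : R) != 0 by rewrite intr_eq0.
have eb : n%:~R * complex.Im a = k%:~R * complex.Im (omegaK R D).
  by rewrite -(Im_linear m k (omegaK R D)) -ena cImM Im_intr Re_intr mul0r addr0.
have eIm : 2 * complex.Re a = T%:~R.
  have := congr1 (@complex.Im _) eq2.
  have -> : a ^+ 2 - T%:~R * a + N%:~R = N%:~R + 1%:~R * (a * a + (- T)%:~R * a) by ring.
  rewrite Im_linear mulr1z mul1r cImD !cImM Im_intr Re_intr mul0r addr0 => e.
  apply: (mulIf a0); apply/eqP; rewrite -subr_eq0 -[X in _ == X]e.
  by apply/eqP; rewrite rmorphN /=; ring.
have eRe : 4 * complex.Im a ^+ 2 = 4 * N%:~R - T%:~R ^+ 2.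
  have := congr1 (@complex.Re _) eq2.
  have -> : a ^+ 2 - T%:~R * a + N%:~R = N%:~R + 1%:~R * (a * a + (- T)%:~R * a) by ring.
  rewrite Re_linear mulr1z mul1r cReD !cReM Im_intr Re_intr mul0r subr0.
  rewrite rmorphN /= -eIm => /(congr1 (fun x => 4 * x)); rewrite mulr0 => e.
  by apply/eqP; rewrite -subr_eq0 -[X in _ == X]oppr0 -e; apply/eqP; ring.
have eD : (2 * complex.Im (omegaK R D)) ^+ 2 = - D%:~R.
  by rewrite Im_omegaK /= sqr_sqrtr ?rmorphN //= oppr_ge0 lerz0 ltW.
have [t [x [ek eT]]] : exists t x : int, k = n * t /\ T = 2 * x + t * D.
  apply: (fund_disc_integral (N := N) n0); apply: (@intr_inj R).
  transitivity (- (n%:~R ^+ 2 * (4 * N%:~R - T%:~R ^+ 2)) : R); first by ring.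
  rewrite -eRe; transitivity (- (4 * (n%:~R * complex.Im a) ^+ 2)); first by ring.
  rewrite eb; transitivity (- (k%:~R ^+ 2 * (2 * complex.Im (omegaK R D)) ^+ 2)).
    by ring.
  by rewrite eD; ring.
exists x, t; apply/eqP; rewrite eq_complex Re_linear Im_linear; apply/andP; split.
  apply/eqP; apply: (@mulfI _ 2); first by rewrite pnatr_eq0.
  rewrite eIm eT.
  have -> : complex.Re (omegaK R D) = D%:~R / 2.
    have := congr1 (@complex.Re _) (omegaK2 R D).
    rewrite -[2 : R[i]]/(2%:~R) cReM Re_intr Im_intr mul0r subr0 cReD Re_intr /= addr0.
    by move=> <-; field.
  by field.
by apply/eqP; apply: (mulfI n0R); rewrite eb ek; ring.
Qed.

Lemma conj_int (m : int) : conjc (m%:~R : R[i]) = m%:~R.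
Proof. exact: rmorph_int. Qed.

Lemma conj_sqrtD : conjc (sqrtD R D) = - sqrtD R D.
Proof. by rewrite /sqrtD; apply/eqP; rewrite eq_complex /= oppr0 !eqxx. Qed.

Lemma conjcD (x y : R[i]) : conjc (x + y) = conjc x + conjc y.
Proof. exact: rmorphD. Qed.

Lemma conjcM (x y : R[i]) : conjc (x * y) = conjc x * conjc y.
Proof. exact: rmorphM. Qed.

Lemma conjcN (x : R[i]) : conjc (- x) = - conjc x.
Proof. exact: rmorphN. Qed.

Lemma conj_form z A B C : cm_form D z A B C ->
  A%:~R * conjc z = - (A%:~R * z + B%:~R) :> R[i].
Proof.
move=> F; have := cm_form_sqrtD F; have := congr1 conjc (cm_form_sqrtD F).
rewrite conj_sqrtD conjcD !conjcM !conj_int (conj_int 2) => e1 e2.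
apply: (@mulfI _ 2); first by rewrite pnatr_eq0.
apply/eqP; rewrite -subr_eq0; apply/eqP.
transitivity ((2 * A%:~R * conjc z + B%:~R) + (2 * A%:~R * z + B%:~R)).
  by ring.
by rewrite -e1 -e2 addNr.
Qed.

Lemma conj_OK x : OK R D x -> OK R D (conjc x).
Proof.
move=> [m [k ->]]; exists (m + k * D), (- k).
have e : conjc (omegaK R D) = D%:~R - omegaK R D.
  rewrite /omegaK conjcM conjc_inv conjcD conj_int conj_sqrtD.
  by rewrite (conj_int 2); field.
by rewrite conjcD conjcM !conj_int e; ring.
Qed.

Lemma inv_lattice_conj z A B C y : cm_form D z A B C ->
  lattice R z y -> inv_lattice z A B (A%:~R * conjc y).
Proof.
move=> F [l [k ->]]; exists l, (- k).
have e1 := conj_form F.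
rewrite conjcD conjcM !conj_int.
transitivity (l%:~R * A%:~R + k%:~R * (A%:~R * conjc z)); first by ring.
by rewrite e1; ring.
Qed.

Lemma lattice_conj z A B C y : cm_form D z A B C ->
  inv_lattice z A B (A%:~R * conjc y) -> lattice R z y.
Proof.
move=> F [m [n e]]; exists m, (- n).
have A0 := cm_form_Aneq0 F.
have -> : y = m%:~R - n%:~R * z; last by ring.
apply: (can_inj (@conjcK R)); apply: (mulfI A0); rewrite e.
have e1 := conj_form F.
rewrite conjcD conjcN conjcM !conj_int.
transitivity (m%:~R * A%:~R - n%:~R * (A%:~R * conjc z)); last by ring.
by rewrite e1; ring.
Qed.

(** The lattice is the conjugate of the ideal, scaled to contain 1: the inverse of [b_z] is
    homothetic to its conjugate, so an ideal [w b_z^-1] determines the class of [b_z] through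
    conjugation. The multiplier ring is [O_K] because every multiplier is integral. *)
Lemma ideal_lattice I : integral_ideal R D I -> exists (c w : R[i]),
  [/\ c != 0, 0 < complex.Im w, cm_by_OK R D w &
      forall x, lattice R w x <-> I (c * conjc x)].
Proof.
move=> iI; have [c [m [g [c0 g0 bI]]]] := integral_ideal_basis D0 Df iI.
have [sI [mI _]] := iI.
have c0C : (c%:R : R[i]) != 0 by rewrite pnatr_eq0 -lt0n.
have conjc_c : conjc (c%:R : R[i]) = c%:R by rewrite rmorph_nat.
pose v : R[i] := m%:~R + g%:R * omegaK R D.
(* The sign undoes the effect of conjugation on the imaginary part. *)
pose w := - conjc v / c%:R.
have ew : conjc w = - v / c%:R.
  by rewrite /w conjcM conjcN conjc_inv conjcK conjc_c.
have w0 : 0 < complex.Im w.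
  have : complex.Im w = complex.Im v / c%:R.
    rewrite /w -(rmorph_nat (real_complex R)) -fmorphV.
    rewrite cImM /= mulr0 add0r; congr (_ * _).
    by case: (v) => x y /=; rewrite opprK.
  move=> ->; apply: divr_gt0; last by rewrite ltr0n.
  by rewrite /v pmulrn Im_linear mulr_gt0 ?Im_omegaK_gt0 // ltr0z.
have latP x : lattice R w x <-> I (c%:R * conjc x).
  split=> [[s [t ->]]|/bI[s [t e]]].
    apply/bI; exists s, (- t); rewrite conjcD conjcM !conj_int ew -/v.
    by field.
  exists s, (- t); apply: (can_inj (@conjcK R)); rewrite conjcD conjcM !conj_int ew.
  by apply: (mulfI c0C); rewrite e -/v; field.
exists c%:R, w; split=> //; apply/seteqP; split=> a.
  move=> ha.
  have la : lattice R w a by rewrite -[a]mulr1; apply: ha; exact: lattice1.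
  have [m1 [n1 e1]] := la.
  have [n10|n10] := eqVneq n1 0; first by rewrite e1 n10 mul0r addr0; exact: OK_int.
  have [m2 [n2 e2]] : lattice R w (a * w) by apply: ha; exists 0, 1; ring.
  have [m' [k' e3]] : OK R D (c%:R * a).
    have /conj_OK : OK R D (c%:R * conjc a) by apply: sI; apply/latP.
    by rewrite conjcM conjcK conjc_c.
  (* Trace and determinant of multiplication by [a] in the basis [1, w]. *)
  apply: (@OK_integral c%:Z m' k' (m1 + n2) (m1 * n2 - n1 * m2)) => //.
  - by rewrite -lt0n.
  - by rewrite e1 Im_linear mulf_neq0 ?intr_eq0 // gt_eqF.
  transitivity (n1%:~R * (a * w - n2%:~R * w - m2%:~R)); last by rewrite e2; ring.
  transitivity ((a - m1%:~R) * (a - n2%:~R) - n1%:~R * m2%:~R); first by ring.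
  have -> : a - m1%:~R = n1%:~R * w by rewrite {1}e1; ring.
  ring.
move=> aO x /latP ix; apply/latP; rewrite conjcM mulrCA.
by apply: mI.2.2 => //; apply: conj_OK.
Qed.

Lemma class_representative (h : nat) (z : 'I_h -> R[i]) (A B C : 'I_h -> int) I :
  (forall a, cm_form D (z a) (A a) (B a) (C a)) ->
  (forall w : R[i], 0 < complex.Im w -> cm_by_OK R D w ->
     exists a, homothetic R (lattice R w) (lattice R (z a))) ->
  integral_ideal R D I ->
  exists a w, [/\ lattice R (z a) w, w != 0 & I = lattice_ideal (z a) (A a) (B a) w].
Proof.
move=> F reps iI; have [c [w' [c0 w0 cmw latP]]] := ideal_lattice iI.
have [a [l0 [l00 el]]] := reps _ w0 cmw; have Fa := F a.
have A0 := cm_form_Aneq0 Fa.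
have cl0 : conjc l0 != 0 by rewrite conjc_eq0.
(* The ideal is [c] times the conjugate of [l0^-1 b_z], and the conjugate of [b_z] is its inverse
   divided by [A]. *)
exists a; pose w := c / ((A a)%:~R * conjc l0).
have w00 : w != 0 by rewrite /w mulf_neq0 // invr_eq0 mulf_neq0.
have eI : I = lattice_ideal (z a) (A a) (B a) w.
  apply/seteqP; split=> [y iy|_ [s si <-]].
    exists ((A a)%:~R * conjc l0 * y / c); last by rewrite /w; field; rewrite c0 A0 cl0.
    have : lattice R (z a) (l0 * conjc (y / c)).
      rewrite el; exists (conjc (y / c)) => //; apply/latP.
      by rewrite conjcK mulrCA divff // mulr1.
    move=> /(inv_lattice_conj Fa); rewrite (conjcM l0) conjcK.
    by rewrite !mulrA.
  have : lattice R (z a) (conjc (s / (A a)%:~R)).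
    by apply: (lattice_conj Fa); rewrite conjcK mulrCA divff // mulr1.
  rewrite el => -[x /latP ix ex].
  have -> // : w * s = c * conjc x.
  have := congr1 conjc ex; rewrite conjcK (conjcM l0) => ex'.
  have -> : conjc x = s / (A a)%:~R / conjc l0 by rewrite -ex'; field.
  by rewrite /w; field; rewrite A0 cl0.
exists w; split=> //; apply: (lattice_dualP D0 Fa) => s si.
by apply: iI.1; rewrite eI; exists s.
Qed.

End Classes.

(** * Hecke characters *)

Section Hecke.
Variables (R : realType) (D : int) (cf : set R[i]) (phi : set R[i] -> R[i]).
Hypotheses (D0 : D < 0) (Df : fund_disc D) (Hphi : hecke_char R D cf phi).

Lemma conductor_sub : cf `<=` OK R D. Proof. by case: Hphi => -[]. Qed.

Lemma conductor_OK_module : OK_module R D cf. Proof. by case: Hphi => -[_ []]. Qed.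

Lemma principal_sub (a : R[i]) : OK R D a -> principal R D a `<=` OK R D.
Proof. by move=> aO _ [y [yO ->]]; apply: OK_mul. Qed.

Lemma coprime_1mod t : OK R D t -> cf (1 - t) ->
  coprime_id R D (principal R D t) cf.
Proof.
move=> tO ct; have mc := conductor_OK_module.
apply/coprime_idP => //; [exact: principal_sub|exact: conductor_sub
  |exact: principal_OK_module|].
by exists t, (1 - t); split; [exact: principal_id| |rewrite addrC subrK].
Qed.

Lemma hecke_1mod t : OK R D t -> cf (1 - t) -> phi (principal R D t) = t.
Proof.
move=> tO ct; have [_ [_ [_ [[chi [hchi ephi]] _]]]] := Hphi.
have mc := conductor_OK_module.
have O1 := OK_1 R D.
have c1 : cf (1 - 1) by rewrite subrr; exact: mc.1.
have [_ [e1 n1]] := hchi _ _ O1 O1 (coprime_1mod O1 c1) (coprime_1mod O1 c1).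
have chi1 : chi 1 = 1.
  by apply: (mulfI n1); rewrite -e1 !mulr1.
have [et _] := hchi _ _ O1 tO (coprime_1mod O1 c1) (coprime_1mod tO ct).
by rewrite (ephi _ tO (coprime_1mod tO ct)) -(et ct) chi1 mulr1.
Qed.

(** If 1 were in [cf], both 1 and -1 would be congruent to 1, and [phi] would send their common
    principal ideal to 1 and to -1. *)
Lemma conductor_proper : ~ cf 1.
Proof.
move=> c1; have mc := conductor_OK_module.
have O1 := OK_1 R D; have ON1 : OK R D (-1) by exists (-1), 0; ring.
have eP : principal R D (-1) = principal R D 1.
  apply/seteqP; split=> _ [y [yO ->]]; exists (- y).
    by split; [rewrite -mulN1r; apply: OK_mul|ring].
  by split; [rewrite -mulN1r; apply: OK_mul|ring].
have := hecke_1mod O1; rewrite subrr -eP hecke_1mod //; last first.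
  by rewrite opprK; apply: (OK_module_add mc).
move=> /(_ mc.1) /eqP; rewrite eq_sym -subr_eq0 opprK.
by rewrite -(natrD _ 1 1) pnatr_eq0.
Qed.

Section OneForm.
Variables (z : R[i]) (A B C : int).
Hypothesis F : cm_form D z A B C.
Local Notation Id := (lattice_ideal z A B).

Lemma coprime_lattice_idealP w : lattice R z w ->
  coprime_id R D (Id w) cf <-> exists s, inv_lattice z A B s /\ cf (1 - w * s).
Proof.
move=> lw; have mc := conductor_OK_module.
split=> [/coprime_idP|[s [si cs]]].
  move=> -[||||_ [j [[s si <-] cj e]]].
  - exact: (lattice_ideal_sub D0 F).
  - exact: conductor_sub.
  - exact: (lattice_ideal_OK_module D0 F).
  - by [].
  by exists s; split=> //; rewrite -e addrC addKr.
apply/coprime_idP => //; [exact: (lattice_ideal_sub D0 F)|exact: conductor_sub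
  |exact: (lattice_ideal_OK_module D0 F)|].
by exists (w * s), (1 - w * s); split=> //; [exists s|rewrite addrC subrK].
Qed.

Lemma coprime_lattice_ideal_neq0 w : lattice R z w ->
  coprime_id R D (Id w) cf -> w != 0.
Proof.
move=> lw /(coprime_lattice_idealP lw)[s [_ cs]]; apply/eqP => w0.
by apply: conductor_proper; move: cs; rewrite w0 mul0r subr0.
Qed.

(** Congruence modulo [cf b_z], tested against the inverse lattice so that only membership in [cf]
    is involved. *)
Definition lattice_cong (w w' : R[i]) : Prop :=
  forall u, inv_lattice z A B u -> cf (u * (w' - w)).

Lemma coprime_lattice_cong w w' : lattice R z w -> lattice R z w' ->
  lattice_cong w w' ->
  coprime_id R D (Id w) cf -> coprime_id R D (Id w') cf.
Proof.
move=> lw lw' ww /(coprime_lattice_idealP lw)[s [si cs]].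
apply/(coprime_lattice_idealP lw'); exists s; split=> //.
have -> : 1 - w' * s = (1 - w * s) - s * (w' - w) by ring.
by apply: conductor_OK_module.2.1 => //; apply: ww.
Qed.

Lemma hecke_lattice_cong w w' : lattice R z w -> lattice R z w' ->
  lattice_cong w w' -> coprime_id R D (Id w) cf ->
  phi (Id w') * w = phi (Id w) * w'.
Proof.
move=> lw lw' ww cw; have cw' := coprime_lattice_cong lw lw' ww cw.
have [icf [phiM [phi0 _]]] := Hphi.
have w0 := coprime_lattice_ideal_neq0 lw cw.
have w0' := coprime_lattice_ideal_neq0 lw' cw'.
have mc := conductor_OK_module.
have [s [si cs]] := (coprime_lattice_idealP lw).1 cw.
have cs' : cf (1 - w' * s).
  have -> : 1 - w' * s = (1 - w * s) - s * (w' - w) by ring.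
  by apply: mc.2.1 => //; apply: ww.
have s0 : s != 0.
  by apply/eqP => s0; apply: conductor_proper; move: cs; rewrite s0 mulr0 subr0.
set J := [set s * y | y in lattice R z].
have iJ : integral_ideal R D J by apply: (cofactor_integral D0 F).
have cJ : coprime_id R D J cf.
  apply/coprime_idP => //; [exact: iJ.1|exact: conductor_sub|exact: iJ.2.1|].
  exists (w * s), (1 - w * s); split=> //; last by rewrite addrC subrK.
  by exists w => //; rewrite mulrC.
have fJ := integral_frac_prime_to D0 Df icf iJ cJ.
have H v : lattice R z v -> v != 0 -> coprime_id R D (Id v) cf ->
    cf (1 - v * s) -> phi (Id v) * phi J = v * s.
  move=> lv v0 cv cvs.
  rewrite -phiM //; last first.
    apply: integral_frac_prime_to => //.
    exact: (lattice_ideal_integral D0 F).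
  rewrite (imul_cofactor D0 Df F) hecke_1mod //.
  exact: (lattice_ideal_mem D0 F).
apply: (mulIf (phi0 _ fJ)); apply: (mulIf s0).
transitivity (phi (Id w') * phi J * (w * s)); first by ring.
rewrite H //; transitivity (phi (Id w) * phi J * (w' * s)); last by ring.
by rewrite (H w) //; ring.
Qed.

End OneForm.

(** * Orbits and divisors of the ideal generated by [f sqrt(D)] *)

Section Orbit.
Variable f : nat.
Hypotheses (f0 : (0 < f)%N) (dvd : idvd R D cf (cbar R D f)).
Hypothesis reps : forall I, integral_ideal R D I -> exists z A B C w,
  [/\ cm_form D z A B C, lattice R z w, w != 0 & I = lattice_ideal z A B w].
Local Notation c := (f%:R * sqrtD R D).

Lemma cbar_gen_neq0 : c != 0 :> R[i].
Proof. by rewrite mulf_neq0 ?pnatr_eq0 -?lt0n // sqrtD_neq0. Qed.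

Lemma cbar_sub_conductor : cbar R D f `<=` cf.
Proof.
have [M [iM ->]] := dvd; apply: imul_sub; first exact: conductor_OK_module.
by move=> x y cx My; rewrite mulrC; apply: conductor_OK_module.2.2 => //; apply: iM.1.
Qed.

Lemma OK_sqrtD : OK R D (sqrtD R D).
Proof.
have -> : sqrtD R D = 2 * omegaK R D - D%:~R by rewrite omegaK2; ring.
by exists (- D), 2; ring.
Qed.

Lemma cbar_gen_OK : OK R D c.
Proof. by rewrite pmulrn; apply: (OK_mul D0 Df); [exact: OK_int|exact: OK_sqrtD]. Qed.

Lemma Kset_div_cbar_gen x : Kset R D x -> Kset R D (x / c).
Proof.
move=> [r [s ->]]; exists (s / f%:R), (r / (f%:R * D%:~R)).
have D00 : (D%:~R : R[i]) != 0 by rewrite intr_eq0 lt_eqF.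
have f00 : (f%:R : R[i]) != 0 by rewrite pnatr_eq0 -lt0n.
have s0 := sqrtD_neq0 R D0.
rewrite !rmorphM !fmorphV rmorphM rmorph_nat rmorph_int -(sqr_sqrtD R D0).
by field; rewrite s0 f00.
Qed.

(** To contain is to divide: if the generator is [w s] in the ideal [w b_z^-1], the complementary
    factor is [s b_z]. *)
Lemma idvd_cbar I : integral_ideal R D I -> I c -> idvd R D I (cbar R D f).
Proof.
move=> iI; have [z [A [B [C [w [F lw w0 ->]]]]]] := reps iI.
move=> [s si es]; exists [set s * y | y in lattice R z]; split.
  apply: (cofactor_integral D0 F) => //; apply/eqP => s0.
  by have := cbar_gen_neq0; rewrite -es s0 mulr0 eqxx.
by rewrite (imul_cofactor D0 Df F) es.
Qed.

(** With [c = f sqrt(D)], the condition that [a w] lies in [c b_z] says that [a / c] maps [I(w)]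
    into [O_K], and [a] in [O_K] says that it maps [(c)] into [O_K]. Together [a / c] lies in the
    inverse of [I(w) + (c)]. This sum inherits primality to [cf] from [I(w)]. *)
Lemma orbit_ideal z A B C w : cm_form D z A B C -> lattice R z w ->
  coprime_id R D (lattice_ideal z A B w) cf ->
  exists Q : set R[i], integral_ideal R D Q /\ idvd R D Q (cbar R D f) /\
    coprime_id R D Q cf /\
    [set a | OK R D a /\ imul R (cbar R D f) (lattice R z) (a * w)] =
    imul R (cbar R D f) (Defs.iinv R D Q).
Proof.
move=> F lw cw; have w0 := coprime_lattice_ideal_neq0 F lw cw.
have iI := lattice_ideal_integral D0 F lw w0.
set I := lattice_ideal z A B w in cw iI *.
have c0 := cbar_gen_neq0; have cO := cbar_gen_OK.
have mc : OK_module R D (cbar R D f) by exact: principal_OK_module.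
have sc : cbar R D f `<=` OK R D by apply: principal_sub.
pose Q := iadd R I (cbar R D f).
have mQ : OK_module R D Q.
  split; first by exists 0, 0; rewrite addr0; split; [exact: iI.2.1.1|split=> //; exact: mc.1].
  split=> [_ _ [i [j [ii [cj ->]]]] [i' [j' [ii' [cj' ->]]]]|a _ aO [i [j [ii [cj ->]]]]].
    exists (i - i'), (j - j'); split; first exact: iI.2.1.2.1.
    by split; [exact: mc.2.1|ring].
  exists (a * i), (a * j); split; first exact: iI.2.1.2.2.
  by split; [exact: mc.2.2|ring].
have IQ : I `<=` Q by move=> i ii; exists i, 0; rewrite addr0; split=> //; split=> //; exact: mc.1.
have cQ : cbar R D f `<=` Q.
  by move=> i ii; exists 0, i; rewrite add0r; split=> //; exact: iI.2.1.1.
have iQ : integral_ideal R D Q.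
  split; first by move=> _ [i [j [ii [cj ->]]]]; apply: OK_add; [exact: iI.1|exact: sc].
  split=> //; have [x [ix x0]] := iI.2.2; by exists x; split=> //; apply: IQ.
have cc : cbar R D f c by exact: principal_id.
exists Q; split=> //; split; first exact: idvd_cbar (cQ _ cc).
split.
  have [s [si cs]] := (coprime_lattice_idealP F lw).1 cw.
  apply/coprime_idP => //; [exact: iQ.1|exact: conductor_sub|exact: conductor_OK_module|].
  exists (w * s), (1 - w * s); split=> //; last by rewrite addrC subrK.
  by apply: IQ; exists s.
rewrite /cbar !imul_principal //; last 2 first.
- split; first by split=> [|y _]; rewrite ?mul0r; [exact: OK_Kset (OK_int R D 0)|exact: (OK_int R D 0)].
  split=> [x y [kx hx] [ky hy]|a x aO [kx hx]]; split.
  + move: kx ky => [r [s ->]] [r' [s' ->]]; exists (r - r'), (s - s').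
    by rewrite !rmorphB; ring.
  + by move=> t Qt; rewrite mulrBl; apply: OK_sub; [apply: hx|apply: hy].
  + move: (OK_Kset aO) kx => [r [s ->]] [r' [s' ->]].
    exists (r * r' + s * s' * D%:~R), (r * s' + s * r').
    rewrite !rmorphD !rmorphM rmorph_int -(sqr_sqrtD R D0); ring.
  + by move=> t Qt; rewrite -mulrA; apply: OK_mul => //; apply: hx.
- exact: (lattice_OK_module D0 F).
apply/seteqP; split=> [a [aO [y ly ey]]|_ [x [kx hx] <-]].
  exists (a / c); last by rewrite mulrC divfK.
  split; first exact/Kset_div_cbar_gen/OK_Kset.
  move=> _ [_ [_ [[s si <-] [[j [jO ->]] ->]]]].
  have -> : a / c * (w * s + c * j) = s * y + a * j.
    have -> : y = a * w / c by rewrite -ey mulrC mulKf.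
    by move: c0; set d := c => d0; field.
  by apply: OK_add; [exact: (inv_lattice_mul D0 F)|exact: OK_mul].
split; first by rewrite mulrC; apply: hx; apply: cQ.
exists (x * w); last by rewrite mulrA.
apply: (lattice_dualP D0 F) => s si; rewrite -mulrA; apply: hx; apply: IQ.
by exists s.
Qed.

End Orbit.
End Hecke.

(** * The discriminant group *)

Local Close Scope classical_set_scope.

Lemma card_ker_im (U : finZmodType) (g : {additive (U * U)%type -> (U * U)%type}) :
  (#|[set v : U * U | g v == 0%R]| * #|g @: [set: U * U]| = #|{: U * U}|)%N.
Proof.
rewrite -[RHS]cardsT -[RHS]sum1_card [RHS](partition_big_imset g) /=.
rewrite [RHS](eq_bigr (fun=> #|[set v : U * U | g v == 0%R]|)); last first.
  move=> _ /imsetP[v0 _ ->]; rewrite sum1dep_card.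
  rewrite -[RHS](card_imset _ (@addrI (U * U)%type v0)); apply: eq_card => v.
  apply/idP/imsetP => [|[k]]; rewrite !inE => /eqP e.
    by exists (v - v0); rewrite ?inE ?raddfB ?e ?subrr // addrC subrK.
  by move=> ->; rewrite raddfD /= e addr0 eqxx.
by rewrite sum_nat_const mulnC.
Qed.

Lemma Zp_intr_eq0 (n : nat) (m : int) : ((m%:~R : 'I_n.+2) == 0) = (n.+2%:Z %| m)%Z.
Proof.
have H k : ((k%:R : 'I_n.+2) == 0) = (n.+2 %| k)%N.
  by rewrite -val_eqE /= (@val_Zp_nat n.+2).
case: m => k; first by rewrite dvdzE /= -H.
by rewrite NegzE rmorphN /= oppr_eq0 dvdzE abszN /= -H.
Qed.

(** [k] and [l] are the pairings of [(P / N, Q / N)] with [e2] and [e1]; the adjugate of the Gram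
    matrix recovers [P] and [Q] from them. *)
Lemma dual_coordP (N : nat) (f A B C P Q : int) : (0 < N)%N ->
  N%:Z = f ^+ 2 * (4 * A * C - B ^+ 2) ->
  ((N%:Z %| f * (2 * A * P + B * Q))%Z && (N%:Z %| f * (B * P + 2 * C * Q))%Z)
  <-> exists l k : int, P = f * (2 * C * k - B * l) /\ Q = f * (2 * A * l - B * k).
Proof.
move=> N0 eN; have f0 : f != 0.
  by apply/eqP => f0; move: N0; rewrite -ltz_nat eN f0 expr0n mul0r.
have d0 : 4 * A * C - B ^+ 2 != 0.
  by apply/eqP => d0; move: N0; rewrite -ltz_nat eN d0 mulr0.
set d := 4 * A * C - B ^+ 2 in eN d0.
split=> [/andP[/dvdzP[k e1] /dvdzP[l e2]]|[l [k [-> ->]]]].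
  have {}e1 : 2 * A * P + B * Q = k * f * d.
    by apply: (mulfI f0); rewrite e1 eN; ring.
  have {}e2 : B * P + 2 * C * Q = l * f * d.
    by apply: (mulfI f0); rewrite e2 eN; ring.
  exists l, k; split; apply: (mulfI d0).
    transitivity (2 * C * (2 * A * P + B * Q) - B * (B * P + 2 * C * Q)).
      by rewrite /d; ring.
    by rewrite e1 e2; ring.
  transitivity (2 * A * (B * P + 2 * C * Q) - B * (2 * A * P + B * Q)).
    by rewrite /d; ring.
  by rewrite e1 e2; ring.
by apply/andP; split; apply/dvdzP; [exists k|exists l]; rewrite eN /d; ring.
Qed.

Section DualCount.
Variables (n : nat) (f A B C : int).
Local Notation Z := 'I_n.+2.

Definition gram_map (v : Z * Z) : Z * Z :=
  (f%:~R * (2 * A%:~R * v.1 + B%:~R * v.2),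
   f%:~R * (B%:~R * v.1 + 2 * C%:~R * v.2)).

Definition cogram_map (v : Z * Z) : Z * Z :=
  (f%:~R * (2 * C%:~R * v.1 - B%:~R * v.2),
   f%:~R * (2 * A%:~R * v.2 - B%:~R * v.1)).

Lemma gram_map_additive : additive gram_map.
Proof. by move=> [a b] [c d]; congr pair => /=; ring. Qed.

HB.instance Definition _ := GRing.isZmodMorphism.Build _ _ gram_map gram_map_additive.

(* The kernel of [gram_map] is the image of [cogram_map], which is conjugate to
   [gram_map]; hence the kernel and the image of [gram_map] have equal size. *)
Lemma card_dual : n.+2%:Z = f ^+ 2 * (4 * A * C - B ^+ 2) ->
  #|[pred pq : Z * Z | (n.+2%:Z %| f * (2 * A * pq.1%:Z + B * pq.2%:Z))%Z &&
                      (n.+2%:Z %| f * (B * pq.1%:Z + 2 * C * pq.2%:Z))%Z]| = n.+2.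
Proof.
move=> eN.
have natZ (x : Z) : x = (x : nat)%:~R by rewrite -pmulrn natr_Zp.
have N0 : (f%:~R ^+ 2 * (4 * A%:~R * C%:~R - B%:~R ^+ 2) : Z) = 0.
  transitivity ((f ^+ 2 * (4 * A * C - B ^+ 2))%:~R : Z); first by ring.
  by rewrite -eN; apply/eqP; rewrite Zp_intr_eq0 dvdzz.
set S' := [pred pq : Z * Z | _].
pose S := [set pq in S'].
have <- : #|S| = #|S'| by apply: eq_card => v; rewrite inE.
have S1 : S = [set v | gram_map v == 0].
  apply/setP => -[p q]; rewrite !inE xpair_eqE /=.
  rewrite -!Zp_intr_eq0 {3 4}(natZ p) {3 4}(natZ q); congr andb; congr (_ == _); ring.
have S2 : S = cogram_map @: [set: Z * Z].
  apply/setP => -[p q]; apply/idP/imsetP => [|[v _ ->]].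
    rewrite inE /= => /(@dual_coordP n.+2 f A B C p q (ltn0Sn _) eN)[l [k [ep eq]]].
    exists (k%:~R, l%:~R); rewrite ?inE // (natZ p) (natZ q) ep eq /cogram_map /=.
    by congr pair; ring.
  rewrite S1 inE /gram_map /cogram_map /=; apply/eqP; congr pair.
    transitivity (f%:~R ^+ 2 * (4 * A%:~R * C%:~R - B%:~R ^+ 2) * v.1); first by ring.
    by rewrite N0 mul0r.
  transitivity (f%:~R ^+ 2 * (4 * A%:~R * C%:~R - B%:~R ^+ 2) * v.2); first by ring.
  by rewrite N0 mul0r.
(* The rotation [(a, b) -> (b, - a)] conjugates the adjugate map into the Gram map, so their images
   are equinumerous. Kernel times image then reads [|S|^2 = N^2]. *)
have S3 : #|gram_map @: [set: Z * Z]| = #|S|.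
  have tinj : injective (fun v : Z * Z => (v.2, - v.1)).
    by move=> [a b] [c d] /pair_equal_spec[/= -> e]; rewrite -[a]opprK e opprK.
  rewrite S2 -[RHS](card_imset _ tinj); apply: eq_card => v.
  apply/imsetP/imsetP => [[u _ ->]|[_ /imsetP[u _ ->] ->]].
    exists (cogram_map (- u.2, u.1)); first by rewrite imset_f ?inE.
    by rewrite /gram_map /cogram_map /=; congr pair; ring.
  exists (u.2, - u.1); rewrite ?inE //.
  by rewrite /gram_map /cogram_map /=; congr pair; ring.
have := card_ker_im (U := Z) gram_map; rewrite -S1 S3 card_prod card_ord => e.
by apply/eqP; rewrite -eqn_sqr -!mulnn e.
Qed.

End DualCount.

Local Open Scope classical_set_scope.

(** * Coordinates on the dual lattice *)

Section DualCoord.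
Variables (R : realType) (D : int) (f : nat) (z : R[i]) (A B C : int).
Hypotheses (D0 : D < 0) (f0 : (0 < f)%N) (F : cm_form D z A B C).
Local Notation N := (gramN f A B C).
Local Notation c := (f%:R * sqrtD R D).

Lemma gramN_disc : N%:Z = f%:Z ^+ 2 * (- D).
Proof.
rewrite /gramN -(cm_form_disc F) PoszM ltz0_abs //; congr (_ * _).
Qed.

Lemma gramN_form : N%:Z = f%:Z ^+ 2 * (4 * A * C - B ^+ 2).
Proof. by rewrite gramN_disc (cm_form_disc F); ring. Qed.

(** -1 is not a square modulo 4. The strict bound makes [N] at least 2, so that ['I_N] is a ring and
    [card_dual] applies. *)
Lemma disc_le : 1 < - D.
Proof.
have D1 : D != -1.
  apply/eqP => e; have := cm_form_disc F; rewrite e.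
  by have [q [->|->]] := intz_parity B; lia.
by move: D0 D1; clear; lia.
Qed.

Lemma gramN_gt1 : (1 < N)%N.
Proof.
rewrite -ltz_nat gramN_disc; have := disc_le; have : 1 <= f%:Z ^+ 2.
  by rewrite expr2 -PoszM lez_nat muln_gt0 f0.
by clear; nia.
Qed.

Lemma gramN_gt0 : (0 < N)%N. Proof. exact: ltnW gramN_gt1. Qed.

Lemma cardG_gramN : cardG f A B C = N.
Proof.
rewrite /cardG; have := gramN_gt1; have := gramN_form.
have -> : #|mkset (fun pq : 'I_N * 'I_N => in_dual f A B C pq.1 pq.2)| =
  #|[pred pq : 'I_N * 'I_N | in_dual f A B C pq.1 pq.2]|.
  by apply: eq_card => pq; rewrite !inE; apply/idP/idP => [/set_mem|/mem_set].
rewrite /in_dual; move: (gramN f A B C) => n.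
case: n => [|[|n]] // e _; exact: card_dual.
Qed.

Lemma in_dualP (p q : nat) : in_dual f A B C p q <->
  exists l k : int, p%:Z = f%:Z * (2 * C * k - B * l) /\
                    q%:Z = f%:Z * (2 * A * l - B * k).
Proof. exact: (dual_coordP _ _ gramN_gt0 gramN_form). Qed.

(** Numerators over [N] of the dual vector that [Omega] sends to [l + k z]. *)
Definition dual_coord (l k : int) : int * int :=
  (f%:Z * (2 * C * k - B * l), f%:Z * (2 * A * l - B * k)).

(** The new [(l, k)] once [s e2 + t e1] is added to the dual vector; the increment is the Gram
    matrix applied to [(s, t)]. *)
Definition dual_shift (l k s t : int) : int * int :=
  (l + f%:Z * (B * s + 2 * C * t), k + f%:Z * (2 * A * s + B * t)).

Lemma dual_coord_shift l k s t :
  dual_coord (dual_shift l k s t).1 (dual_shift l k s t).2 =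
  ((dual_coord l k).1 + N%:Z * s, (dual_coord l k).2 + N%:Z * t).
Proof. by rewrite gramN_form /dual_coord /dual_shift /=; congr pair; ring. Qed.

Lemma dual_coord_inj l k l' k' :
  dual_coord l k = dual_coord l' k' -> (l, k) = (l', k').
Proof.
have N0 : N%:Z != 0 by rewrite eqz_nat -lt0n gramN_gt0.
have f0Z : f%:Z != 0 by rewrite eqz_nat -lt0n.
move=> /pair_equal_spec[e1 e2]; congr pair; apply: (mulfI N0); rewrite gramN_form.
  transitivity (f%:Z * (B * (f%:Z * (2 * C * k - B * l)) + 2 * C * (f%:Z * (2 * A * l - B * k)))).
    by ring.
  by rewrite e1 e2; ring.
transitivity (f%:Z * (2 * A * (f%:Z * (2 * C * k - B * l)) + B * (f%:Z * (2 * A * l - B * k)))).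
  by ring.
by rewrite e1 e2; ring.
Qed.

Lemma dual_shift_inj l k s t s' t' :
  dual_shift l k s t = dual_shift l k s' t' -> (s, t) = (s', t').
Proof.
have N0 : N%:Z != 0 by rewrite eqz_nat -lt0n gramN_gt0.
move=> e; have := dual_coord_shift l k s t; rewrite e dual_coord_shift.
by move=> /pair_equal_spec[/addrI/(mulfI N0) -> /addrI/(mulfI N0) ->].
Qed.

Lemma dual_shift_lattice l k s t :
  let m := dual_shift l k s t in
  m.1%:~R + m.2%:~R * z = (l%:~R + k%:~R * z) + c * (s%:~R - t%:~R * z).
Proof.
rewrite /= (cm_form_sqrtD F).
transitivity (l%:~R + k%:~R * z + f%:R * ((2 * A%:~R * z + B%:~R) * s%:~R
  - B%:~R * t%:~R * z - 2 * t%:~R * (A%:~R * z ^+ 2))); last by ring.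
by rewrite (cm_form_sqr D0 F); ring.
Qed.

Lemma rC_div (x : int) (n : nat) : rC R (x%:~R / n%:R) = x%:~R / n%:R.
Proof. by rewrite -[LHS]/((x%:~R / n%:R)%:C)%C rmorphM fmorphV rmorph_int rmorph_nat. Qed.

Lemma Omega_aux (l k : int) :
  let m := dual_coord l k in
  rC R (m.1%:~R / N%:R) - rC R (m.2%:~R / N%:R) * z = (l%:~R + k%:~R * z) / c.
Proof.
rewrite /= !rC_div.
have f00 : (f%:R : R[i]) != 0 by rewrite pnatr_eq0 -lt0n.
have s0 := sqrtD_neq0 R D0.
have -> : (N%:R : R[i]) = - (f%:R ^+ 2 * sqrtD R D ^+ 2).
  by rewrite pmulrn gramN_disc (sqr_sqrtD R D0); ring.
apply: (@mulfI _ (- (f%:R ^+ 2 * sqrtD R D ^+ 2))).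
  by rewrite oppr_eq0 mulf_neq0 // expf_neq0.
have e : (f%:Z * (2 * C * k - B * l))%:~R - (f%:Z * (2 * A * l - B * k))%:~R * z
   = - (f%:R * sqrtD R D * (l%:~R + k%:~R * z)).
  rewrite (cm_form_sqrtD F).
  transitivity (f%:R * (2 * C%:~R * k%:~R - B%:~R * l%:~R - 2 * A%:~R * l%:~R * z
    + B%:~R * k%:~R * z)); first by ring.
  transitivity (- (f%:R * (2 * A%:~R * z * l%:~R + B%:~R * (l%:~R + k%:~R * z) +
      2 * k%:~R * (A%:~R * z ^+ 2)))); last by ring.
  by rewrite (cm_form_sqr D0 F); ring.
transitivity ((f%:Z * (2 * C * k - B * l))%:~R - (f%:Z * (2 * A * l - B * k))%:~R * z).
  by field; rewrite f00 s0.
by rewrite e; field; rewrite f00 s0.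
Qed.

(** The ratio of [Omega'] to [Omega]: since [|G| = f^2 |D|], the factor [i sqrt |G|] is
    [f sqrt(D)]. *)
Definition kappa : R[i] := rC R (Num.sqrt (2%:R * A%:~R * f%:R)) / c.

Lemma sqrt2Af_neq0 : rC R (Num.sqrt (2%:R * A%:~R * f%:R)) != 0.
Proof.
rewrite eq_complex /= eqxx andbT sqrtr_eq0 -ltNge !mulr_gt0 ?ltr0n //.
by rewrite ltr0z (cm_form_Agt0 F).
Qed.

Lemma kappa_neq0 : kappa != 0.
Proof.
rewrite mulf_neq0 ?sqrt2Af_neq0 // invr_eq0 mulf_neq0 ?sqrtD_neq0 //.
by rewrite pnatr_eq0 -lt0n.
Qed.

Lemma Omega'_dual (l k : int) :
  let m := dual_coord l k in
  Omega' R f A z (m.1%:~R / N%:R) (m.2%:~R / N%:R) = kappa * (l%:~R + k%:~R * z).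
Proof. by rewrite /Omega' /= Omega_aux /kappa; ring. Qed.

Lemma Omega_dual (l k : int) :
  let m := dual_coord l k in
  Omega R f A B C z (m.1%:~R / N%:R) (m.2%:~R / N%:R) = l%:~R + k%:~R * z.
Proof.
rewrite /Omega Omega'_dual cardG_gramN /kappa.
set w := l%:~R + _.
have f00 : (f%:R : R[i]) != 0 by rewrite pnatr_eq0 -lt0n.
have s0 := sqrtD_neq0 R D0.
have e1 : iC R * rC R (Num.sqrt N%:R) = c.
  have -> : (N%:R : R) = (f%:R ^+ 2) * (- D)%:~R.
    by rewrite pmulrn gramN_disc; ring.
  rewrite sqrtrM ?sqr_ge0 // sqrtr_sqr ger0_norm //.
  rewrite -(rmorph_nat (real_complex R)) /iC /rC /sqrtD.
  by apply/eqP; rewrite eq_complex /= !(mul0r, mulr0, mul1r, subr0, addr0, add0r) !eqxx.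
have e2 : rC R (Num.sqrt (2%:R * A%:~R * f%:R))^-1 =
    (rC R (Num.sqrt (2%:R * A%:~R * f%:R)))^-1.
  exact: (fmorphV (real_complex R)).
by rewrite e1 e2; field; rewrite f00 s0 sqrt2Af_neq0.
Qed.

Lemma gram_qf_dual (l k : int) :
  let m := dual_coord l k in
  f%:R * (- D)%:~R * gram_qf R f A B C (m.1%:~R / N%:R) (m.2%:~R / N%:R) =
  2 * (norm_form A B C l k)%:~R.
Proof.
have f00 : (f%:R : R) != 0 by rewrite pnatr_eq0 -lt0n.
have d0 : ((- D)%:~R : R) != 0 by rewrite intr_eq0 oppr_eq0 lt_eqF.
rewrite /gram_qf /dual_coord /norm_form /=.
have -> : (N%:R : R) = (f%:R ^+ 2) * (- D)%:~R by rewrite pmulrn gramN_disc; ring.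
transitivity (2 * ((A * (2 * C * k - B * l) ^+ 2 +
   B * (2 * C * k - B * l) * (2 * A * l - B * k) + C * (2 * A * l - B * k) ^+ 2)%:~R)
  / (- D)%:~R : R).
  by field; rewrite f00 intr_eq0 lt_eqF.
have -> : A * (2 * C * k - B * l) ^+ 2 +
   B * (2 * C * k - B * l) * (2 * A * l - B * k) + C * (2 * A * l - B * k) ^+ 2
  = - D * (A * l ^+ 2 - B * l * k + C * k ^+ 2) by rewrite (cm_form_disc F); ring.
by rewrite intrM; field; rewrite intr_eq0 lt_eqF.
Qed.

Lemma exponent_dual (tau : R[i]) (l k : int) :
  let m := dual_coord l k in
  rC R pi * iC R * (f%:R * (- D)%:~R) * tau *
    rC R (gram_qf R f A B C (m.1%:~R / N%:R) (m.2%:~R / N%:R)) =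
  2%:R * rC R pi * iC R * tau * (norm_form A B C l k)%:~R.
Proof.
have rCM x y : rC R (x * y) = rC R x * rC R y by exact: (rmorphM (real_complex R)).
have rCi m : rC R m%:~R = m%:~R by exact: (rmorph_int (real_complex R)).
have rCn n : rC R n%:R = n%:R by exact: (rmorph_nat (real_complex R)).
have e := congr1 (rC R) (gram_qf_dual l k).
move: e; rewrite (rCM (f%:R * _)) (rCM f%:R) (rCM 2) !rCi (rCn f) (rCn 2%N) => e.
transitivity (rC R pi * iC R * tau * (f%:R * (- D)%:~R *
   rC R (gram_qf R f A B C ((dual_coord l k).1%:~R / N%:R)
                           ((dual_coord l k).2%:~R / N%:R)))); first by rewrite /=; ring.
by rewrite e; ring.
Qed.

End DualCoord.

(** * Absolutely convergent sums *)

Lemma ler_sum_uniq (R : realType) (T : eqType) (a : T -> R) (s s' : seq T) :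
  (forall t, 0 <= a t) -> uniq s -> uniq s' -> {subset s <= s'} ->
  \sum_(t <- s) a t <= \sum_(t <- s') a t.
Proof.
move=> a0 us us' ss'; rewrite [leRHS](bigID (mem s)) /= -[leLHS]addr0.
apply: lerD; last exact: sumr_ge0.
have p : perm_eq s [seq t <- s' | t \in s].
  apply: uniq_perm => //; first exact: filter_uniq.
  by move=> t; rewrite mem_filter; apply/esym/andb_idr/ss'.
by rewrite (perm_big _ p) /= big_filter.
Qed.

(** Points outside [P] may occur or not. With [P] the support of a family, orderings that differ on
    zero terms can be compared. *)
Definition exhausts (T : eqType) (P : pred T) (S : nat -> seq T) : Prop :=
  (forall M, uniq (S M)) /\
  (forall t, P t -> exists M0, forall M, (M0 <= M)%N -> t \in S M).

Lemma exhausts_seq (T : eqType) (P : pred T) (S : nat -> seq T) (s : seq T) :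
  exhausts P S -> all P s ->
  exists M0, forall M, (M0 <= M)%N -> {subset s <= S M}.
Proof.
move=> [_ eS]; elim: s => [|t s ih] /=; first by exists 0%N.
move=> /andP[/eS[M1 h1] /ih[M2 h2]]; exists (maxn M1 M2) => M.
rewrite geq_max => /andP[/h1 tM /h2 sM] x; rewrite inE => /orP[/eqP ->//|/sM].
by [].
Qed.

Section Summation.
Variables (R : realType) (T : eqType).

(** The limit is the supremum of all finite sums, hence chosen before the exhaustion; this order of
    quantifiers is what permits rearrangement. *)
Lemma nonneg_sum_cvg (a : T -> R) (K : R) : (forall t, 0 <= a t) ->
  (forall s, uniq s -> \sum_(t <- s) a t <= K) ->
  exists L : R, forall S, exhausts (fun t => a t != 0) S ->
    (fun M => \sum_(t <- S M) a t) @ \oo --> L.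
Proof.
move=> a0 aK.
pose E := [set x : R | exists2 s, uniq s & x = \sum_(t <- s) a t].
have hE : has_sup E.
  by split; [exists (\sum_(t <- [::]) a t), [::]|exists K => _ [s us ->]; exact: aK].
exists (sup E) => S eS; apply/cvgrPdist_lt => e e0.
have [_ [s us ->] hs] := sup_adherent e0 hE.
(* An exhaustion only has to reach the nonzero terms. *)
pose s1 := [seq t <- s | a t != 0].
have es1 : \sum_(t <- s) a t = \sum_(t <- s1) a t.
  by rewrite [RHS]big_filter [RHS]big_mkcond /=; apply: eq_bigr => t _; case: eqVneq.
have [M0 hM0] := exhausts_seq eS (filter_all (fun t => a t != 0) s).
exists M0 => // M /= M0M.
have le1 : \sum_(t <- S M) a t <= sup E.
  by apply: (ub_le_sup hE.2); exists (S M) => //; exact: eS.1.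
have le2 : \sum_(t <- s) a t <= \sum_(t <- S M) a t.
  rewrite es1; apply: ler_sum_uniq => //; [exact: filter_uniq|exact: eS.1|exact: hM0].
by rewrite ger0_norm ?subr_ge0 // ltrBlDr -ltrBlDl; exact: lt_le_trans hs le2.
Qed.

Lemma real_sum_cvg (a b : T -> R) (K : R) :
  (forall t, `|a t| <= b t) ->
  (forall s, uniq s -> \sum_(t <- s) b t <= K) ->
  exists L : R, forall S, exhausts (fun t => a t != 0) S ->
    (fun M => \sum_(t <- S M) a t) @ \oo --> L.
Proof.
move=> ab bK.
have [L1 h1] : exists L : R, forall S,
    exhausts (fun t => Num.max (a t) 0 != 0) S ->
    (fun M => \sum_(t <- S M) Num.max (a t) 0) @ \oo --> L.
  apply: (@nonneg_sum_cvg _ K) => [t|s us]; first by rewrite le_max lexx orbT.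
  apply: le_trans (bK s us); apply: ler_sum => t _.
  by apply: le_trans (ab t); rewrite ge_max ler_norm normr_ge0.
have [L2 h2] : exists L : R, forall S,
    exhausts (fun t => Num.max (- a t) 0 != 0) S ->
    (fun M => \sum_(t <- S M) Num.max (- a t) 0) @ \oo --> L.
  apply: (@nonneg_sum_cvg _ K) => [t|s us]; first by rewrite le_max lexx orbT.
  apply: le_trans (bK s us); apply: ler_sum => t _.
  by apply: le_trans (ab t); rewrite ge_max -normrN ler_norm normr_ge0.
exists (L1 - L2) => S [uS eS].
have -> : (fun M => \sum_(t <- S M) a t) =
    (fun M => \sum_(t <- S M) Num.max (a t) 0 - \sum_(t <- S M) Num.max (- a t) 0).
  apply/funext => M; rewrite -sumrB; apply: eq_bigr => t _.
  have [a0|a0] := leP 0 (a t).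
    by rewrite max_r ?oppr_le0 // subr0.
  by rewrite max_l ?oppr_ge0 ?ltW // sub0r opprK.
apply: cvgB; [apply: h1|apply: h2]; split=> // t h; apply: eS; apply: contra_neq h => ->.
  by rewrite maxxx.
by rewrite oppr0 maxxx.
Qed.

Lemma cvg_complex (u : nat -> R[i]) (a b : R) :
  (fun M => complex.Re (u M)) @ \oo --> a ->
  (fun M => complex.Im (u M)) @ \oo --> b ->
  (u : nat -> (R[i])^o) @ \oo --> (Complex a b : (R[i])^o).
Proof.
move=> /cvgrPdist_lt ha /cvgrPdist_lt hb; apply/cvgrPdist_lt => e e0.
(* The norm takes values in [R[i]], so [e] is complex; being positive, it is real. *)
have [Ie Re0] : complex.Im e = 0 /\ 0 < complex.Re e.
  by move: e0; rewrite ltcE /= => /andP[/eqP -> ->].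
have e2 : 0 < complex.Re e / 2 by rewrite divr_gt0.
have := ha _ e2; have := hb _ e2; apply: filterS2 => M hb' ha'.
rewrite normc_def ltcE /= Ie eqxx /=.
case: (u M) ha' hb' => x y /= ha' hb'.
apply: (@le_lt_trans _ _ (`|a - x| + `|b - y|)); last first.
  by rewrite [ltRHS](splitr (complex.Re e)) ltrD.
rewrite -[leRHS]ger0_norm ?addr_ge0 // -sqrtr_sqr ler_wsqrtr //.
rewrite -(real_normK (num_real (a - x))) -(real_normK (num_real (b - y))).
rewrite sqrrD -addrA [_ *+ 2 + _]addrC addrA lerDl mulrn_wge0 // mulr_ge0 //.
Qed.

Lemma complex_sum_cvg (g : T -> R[i]) (b : T -> R) (K : R) :
  (forall t, `|complex.Re (g t)| <= b t) ->
  (forall t, `|complex.Im (g t)| <= b t) ->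
  (forall s, uniq s -> \sum_(t <- s) b t <= K) ->
  exists L : R[i], forall S, exhausts (fun t => g t != 0) S ->
    (fun M => \sum_(t <- S M) g t : (R[i])^o) @ \oo --> (L : (R[i])^o).
Proof.
move=> hRe hIm bK.
have [L1 h1] := real_sum_cvg hRe bK; have [L2 h2] := real_sum_cvg hIm bK.
exists (Complex L1 L2) => S [uS eS]; apply: cvg_complex.
  have -> : (fun M => complex.Re (\sum_(t <- S M) g t)) =
      (fun M => \sum_(t <- S M) complex.Re (g t)).
    by apply/funext => M; apply: (big_morph (@complex.Re R)) => // -[? ?] [? ?].
  by apply: h1; split=> // t h; apply: eS; apply: contra_neq h => ->.
have -> : (fun M => complex.Im (\sum_(t <- S M) g t)) =
    (fun M => \sum_(t <- S M) complex.Im (g t)).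
  by apply/funext => M; apply: (big_morph (@complex.Im R)) => // -[? ?] [? ?].
by apply: h2; split=> // t h; apply: eS; apply: contra_neq h => ->.
Qed.

End Summation.

Lemma climn_eq (R : realType) (u : nat -> R[i]) (L : R[i]) :
  (u : nat -> (R[i])^o) @ \oo --> (L : (R[i])^o) -> climn R u = L.
Proof. by move=> h; rewrite /climn; apply: (cvg_lim _ h); exact: norm_hausdorff. Qed.

(** * Integer boxes and geometric bounds *)

Definition zrange (r : nat) : seq int := [seq i%:Z - r%:Z | i <- iota 0 (2 * r).+1].

Definition zbox (r : nat) : seq (int * int) := [seq (i, j) | i <- zrange r, j <- zrange r].

Lemma mem_zrange r x : (x \in zrange r) = (`|x| <= r%:Z).
Proof.
apply/mapP/idP => [[i0]|h].
  by rewrite mem_iota => /andP[_ hi] ->; lia.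
by exists (absz (x + r%:Z)); [rewrite mem_iota; lia|lia].
Qed.

Lemma uniq_zrange r : uniq (zrange r).
Proof. by rewrite map_inj_uniq ?iota_uniq // => i j /addIr[]. Qed.

Lemma uniq_zbox r : uniq (zbox r).
Proof.
apply: allpairs_uniq; [exact: uniq_zrange|exact: uniq_zrange|].
by move=> [i j] [i' j'] _ _ /= [-> ->].
Qed.

Lemma mem_zbox r x : (x \in zbox r) = (`|x.1| <= r%:Z) && (`|x.2| <= r%:Z).
Proof.
rewrite -!mem_zrange; case: x => i j; apply/allpairsP/andP => /=.
  by move=> [[i' j'] [/= hi hj [-> ->]]].
by move=> [hi hj]; exists (i, j).
Qed.

Lemma geometric_int_bound (R : realType) (q : R) (s : seq int) :
  0 <= q -> q < 1 -> uniq s -> \sum_(i <- s) q ^+ `|i|%N <= 2 / (1 - q).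
Proof.
move=> q0 q1 us.
have geo n : \sum_(i <- iota 0 n) q ^+ i <= 1 / (1 - q).
  have -> : \sum_(i <- iota 0 n) q ^+ i = \sum_(i < n) q ^+ i.
    by rewrite -(big_mkord xpredT (fun i => q ^+ i)) /index_iota subn0.
  have := subrX1 q n; move/(congr1 -%R); rewrite -mulNr !opprB => e.
  rewrite ler_pdivlMr ?subr_gt0 // mulrC -e gerBl exprn_ge0 //.
have [r hr] : exists r, forall i, i \in s -> (absz i < r)%N.
  exists (\max_(i <- s) absz i).+1 => i si.
  by rewrite ltnS; exact: (@leq_bigmax_seq _ s xpredT absz).
pose w := [seq Posz n | n <- iota 0 r] ++ [seq Negz n | n <- iota 0 r].
have uw : uniq w.
  rewrite cat_uniq !map_inj_uniq ?iota_uniq ?andbT /=; last 2 first.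
  - by move=> ? ? [].
  - by move=> ? ? [].
  by apply/hasPn => _ /mapP[n _ ->]; apply/mapP => -[].
have sw : {subset s <= w}.
  move=> i /hr.
  rewrite mem_cat; case: i => n /= h; apply/orP; [left|right];
    apply/mapP; exists n => //; rewrite mem_iota /= add0n //.
  exact: ltnW.
apply: le_trans (ler_sum_uniq _ us uw sw) _; first by move=> t; rewrite exprn_ge0.
rewrite big_cat /= !big_map -[2]/(1 + 1) mulrDl; apply: lerD; first exact: geo.
apply: le_trans (geo r); apply: ler_sum => i _ /=.
by rewrite exprS ler_piMl ?exprn_ge0 // ltW.
Qed.

Lemma geometric_int2_bound (R : realType) (q : R) (s : seq (int * int)) :
  0 <= q -> q < 1 -> uniq s ->
  \sum_(t <- s) q ^+ (`|t.1| + `|t.2|)%N <= (2 / (1 - q)) ^+ 2.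
Proof.
move=> q0 q1 us.
pose r := \max_(t <- s) (maxn `|t.1| `|t.2|)%N.
have sw : {subset s <= zbox r}.
  move=> t st; have : (maxn `|t.1| `|t.2| <= r)%N.
    exact: (@leq_bigmax_seq _ s xpredT (fun t : int * int => maxn `|t.1| `|t.2|)).
  by rewrite mem_zbox geq_max -!lez_nat !abszE.
apply: le_trans (ler_sum_uniq _ us (uniq_zbox r) sw) _.
  by move=> t; rewrite exprn_ge0.
rewrite /zbox big_allpairs /=.
under eq_bigr do under eq_bigr do rewrite exprD.
rewrite -(big_distrlr _ _ _ xpredT xpredT (fun i : int => q ^+ `|i|%N) (fun i : int => q ^+ `|i|%N)) /=.
have h := geometric_int_bound q0 q1 (uniq_zrange r).
rewrite expr2; apply: ler_pM => //; apply: sumr_ge0 => *; exact: exprn_ge0.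
Qed.

(** * The theta series of a class *)

Lemma sqr_ge_absz (x : int) : (`|x|%N)%:Z <= x ^+ 2.
Proof. by rewrite abszE; nia. Qed.

(** A real-valued, submultiplicative substitute for the modulus that dominates the real and the
    imaginary part. *)
Definition l1norm (R : realType) (x : R[i]) : R := `|complex.Re x| + `|complex.Im x|.

Lemma l1normM (R : realType) (x y : R[i]) : l1norm (x * y) <= l1norm x * l1norm y.
Proof.
rewrite /l1norm cReM cImM.
apply: (@le_trans _ _ ((`|complex.Re x * complex.Re y| + `|complex.Im x * complex.Im y|)
  + (`|complex.Re x * complex.Im y| + `|complex.Im x * complex.Re y|))).
  by apply: lerD; [exact: ler_normB|exact: ler_normD].
by rewrite !normrM le_eqVlt; apply/orP; left; apply/eqP; ring.
Qed.

Lemma l1norm_ge0 (R : realType) (x : R[i]) : 0 <= l1norm x.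
Proof. by rewrite addr_ge0. Qed.

Lemma l1norm_cexp (R : realType) (x : R[i]) :
  l1norm (cexp R x) <= 2 * expR (complex.Re x).
Proof.
rewrite /l1norm /cexp /= !normrM ger0_norm ?expR_ge0 // -mulrDr mulrC.
by rewrite ler_wpM2r ?expR_ge0 // -[2]/(1 + 1) lerD // ler_norml ?cos_geN1 ?cos_le1 ?sin_geN1 ?sin_le1.
Qed.

Lemma big_zrange (V : nmodType) (r : nat) (F : int -> V) :
  \sum_(i <- zrange r) F i = \sum_(i < (2 * r).+1) F (i%:Z - r%:Z).
Proof.
rewrite /zrange big_map -(big_mkord xpredT (fun i => F (i%:Z - r%:Z))).
by rewrite /index_iota subn0.
Qed.

Section Terms.
Variables (R : realType) (D : int) (f : nat) (z : R[i]) (A B C : int).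
Hypotheses (D0 : D < 0) (f0 : (0 < f)%N) (F : cm_form D z A B C).
Local Notation N := (gramN f A B C).

Definition lpoint (t : int * int) : R[i] := t.1%:~R + t.2%:~R * z.
Definition lnorm (t : int * int) : int := norm_form A B C t.1 t.2.

Definition qexp (tau : R[i]) (n : int) : R[i] :=
  cexp R (2%:R * rC R pi * iC R * tau * n%:~R).

Lemma cm_form_Cgt0 : 0 < C.
Proof.
have := cm_form_disc F; have := cm_form_Agt0 F; move: D0.
have : 0 <= B ^+ 2 by exact: sqr_ge0.
by clear; nia.
Qed.

(** Completing the square in either variable, with [- D >= 1]. The bound gives positivity of the
    form, finiteness of each norm level and geometric decay of the terms. *)
Lemma lnorm_bound t : (`|t.1| + `|t.2|)%N%:Z <= 4 * (A + C) * lnorm t.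
Proof.
case: t => l k; rewrite /lnorm /=.
have e1 : 4 * A * norm_form A B C l k = (2 * A * l - B * k) ^+ 2 + (- D) * k ^+ 2.
  by rewrite /norm_form (cm_form_disc F); ring.
have e2 : 4 * C * norm_form A B C l k = (2 * C * k - B * l) ^+ 2 + (- D) * l ^+ 2.
  by rewrite /norm_form (cm_form_disc F); ring.
have -> : 4 * (A + C) * norm_form A B C l k = 4 * C * norm_form A B C l k +
   4 * A * norm_form A B C l k by ring.
rewrite e1 e2 PoszD; apply: lerD.
  apply: (le_trans (sqr_ge_absz l)); rewrite -[leLHS]add0r lerD ?sqr_ge0 //.
  by rewrite ler_peMl ?sqr_ge0 // lerNr -ltzD1 -[_ + 1]addrC subrr.
apply: (le_trans (sqr_ge_absz k)); rewrite -[leLHS]add0r lerD ?sqr_ge0 //.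
by rewrite ler_peMl ?sqr_ge0 // lerNr -ltzD1 -[_ + 1]addrC subrr.
Qed.

Lemma lnorm_ge0 t : 0 <= lnorm t.
Proof.
have := lnorm_bound t; have := cm_form_Cgt0; have := cm_form_Agt0 F.
by move: (lnorm t) (`|_| + _)%N => n m; clear; nia.
Qed.

Lemma lnorm_gt0 t : t != (0, 0) -> 0 < lnorm t.
Proof.
move=> t0; rewrite lt_def lnorm_ge0 andbT; apply: contra_neq t0 => n0.
have := lnorm_bound t; rewrite n0 mulr0; case: t {n0} => l k /= h.
by clear -h; congr pair; lia.
Qed.

Lemma lpoint_inj : injective lpoint.
Proof.
by move=> [l k] [l' k'] /(lattice_coord_inj (cm_form_Im_gt0 D0 F))[/= -> ->].
Qed.

Lemma lpoint_eq0 t : (lpoint t == 0) = (t == (0, 0)).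
Proof.
have e0 : lpoint (0, 0) = 0 by rewrite /lpoint /=; ring.
by rewrite -e0 (inj_eq lpoint_inj).
Qed.

Lemma lpoint_lattice t : lattice R z (lpoint t).
Proof. by exists t.1, t.2. Qed.

Lemma Re_qexp_arg (tau : R[i]) (n : int) :
  complex.Re (2%:R * rC R pi * iC R * tau * n%:~R) =
  - (2 * pi * complex.Im tau) * n%:~R.
Proof.
rewrite cReM Im_intr Re_intr mulr0 subr0; congr (_ * _).
rewrite -(rmorph_nat (real_complex R)) /iC /rC; case: tau => a b /=.
by ring.
Qed.

Section Tau.
Variable tau : R[i].
Hypothesis tau0 : 0 < complex.Im tau.

Lemma term_bound : exists K q : R, [/\ 0 <= q, q < 1 &
  forall t, l1norm (lpoint t * qexp tau (lnorm t)) <= K * q ^+ (`|t.1| + `|t.2|)%N].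
Proof.
pose s : R := 2 * pi * complex.Im tau.
have s0 : 0 < s by rewrite !mulr_gt0 // pi_gt0.
have A0 := cm_form_Agt0 F; have C0 := cm_form_Cgt0.
pose c : R := (4 * (A + C))%:~R.
have c0 : 0 < c by rewrite ltr0z mulr_gt0 // addr_gt0.
(* Half of the decay rate [s], spread over [|l| + |k| <= c n]; the other half absorbs the factor
   [2 + n] that bounds the lattice point. *)
pose q := expR (- (s / 2 / c)).
have q1 : q < 1 by rewrite expR_lt1 oppr_lt0 !divr_gt0.
exists (2 * (2 + 2 / s)), q; split=> //; first exact: expR_ge0.
move=> t; apply: (le_trans (l1normM _ _)).
set n : R := (lnorm t)%:~R.
have n0 : 0 <= n by rewrite ler0z lnorm_ge0.
have h1 : l1norm (lpoint t) <= 2 + n.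
  have nE := sqr_norm_form D0 F t.1 t.2; rewrite -/(lnorm t) -/n -/(lpoint t) in nE.
  have A1 : 1 <= A%:~R :> R by rewrite -[1]/(1%:~R) ler_int -gtz0_ge1.
  have le_sq (x : R) : `|x| <= 1 + x ^+ 2.
    by rewrite ler_norml; apply/andP; split; nra.
  apply: (@le_trans _ _ (2 + (complex.Re (lpoint t) ^+ 2 + complex.Im (lpoint t) ^+ 2))).
    rewrite /l1norm; have := le_sq (complex.Re (lpoint t)).
    by have := le_sq (complex.Im (lpoint t)); lra.
  by rewrite lerD2l nE ler_peMl // addr_ge0 ?sqr_ge0.
have h2 : l1norm (qexp tau (lnorm t)) <= 2 * expR (- s * n).
  by apply: (le_trans (l1norm_cexp _)); rewrite Re_qexp_arg.
have h : (`|t.1| + `|t.2|)%N%:R <= c * n.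
  by rewrite -intrM pmulrn ler_int lnorm_bound.
apply: (le_trans (ler_pM (l1norm_ge0 _) (l1norm_ge0 _) h1 h2)).
clearbody s c n.
have -> : - s * n = - (s * n / 2) + - (s * n / 2) by field.
rewrite expRD.
(* From [1 + x <= exp x] at [x = s n / 2]; the constant [2 + 2 / s] is chosen so that its product
   with [1 + x] exceeds [2 + n]. *)
have h3 : (2 + n) * expR (- (s * n / 2)) <= 2 + 2 / s.
  rewrite expRN ler_pdivrMr ?expR_gt0 //.
  apply: (@le_trans _ _ ((2 + 2 / s) * (1 + s * n / 2))); last first.
    by rewrite ler_wpM2l ?expR_ge1Dx // addr_ge0 // divr_ge0 // ltW.
  have -> : (2 + 2 / s) * (1 + s * n / 2) = 2 + n + (s * n + 2 / s).
    by field; rewrite gt_eqF.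
  by rewrite lerDl addr_ge0 ?divr_ge0 ?mulr_ge0 // ltW.
have h4 : expR (- (s * n / 2)) <= q ^+ (`|t.1| + `|t.2|)%N.
  rewrite -expRM_natl ler_expR mulrN lerN2.
  apply: (@le_trans _ _ (c * n * (s / 2 / c))).
    by rewrite ler_wpM2r // ltW // !divr_gt0.
  by rewrite le_eqVlt; apply/orP; left; apply/eqP; field; rewrite gt_eqF.
have -> : (2 + n) * (2 * (expR (- (s * n / 2)) * expR (- (s * n / 2)))) =
  2 * (((2 + n) * expR (- (s * n / 2))) * expR (- (s * n / 2))) by ring.
rewrite -[leRHS]mulrA ler_wpM2l //; apply: ler_pM => //; rewrite ?expR_ge0 //.
by rewrite mulr_ge0 ?expR_ge0 // addr_ge0.
Qed.

Definition dual_class (p q : nat) (t : int * int) : bool :=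
  (N%:Z %| (dual_coord f A B C t.1 t.2).1 - p%:Z)%Z &&
  (N%:Z %| (dual_coord f A B C t.1 t.2).2 - q%:Z)%Z.

(** The general term of [f_a(tau; beta)], extended by zero off the coset so that all [beta] share
    one index set. *)
Definition class_term (p q : nat) (t : int * int) : R[i] :=
  if dual_class p q t then kappa R D f A * (lpoint t * qexp tau (lnorm t)) else 0.

Lemma class_term0 p q : class_term p q (0, 0) = 0.
Proof.
have /eqP e0 : lpoint (0, 0) == 0 by rewrite lpoint_eq0.
by rewrite /class_term e0 mul0r mulr0 if_same.
Qed.

Lemma dual_classP p q l k t : dual_coord f A B C l k = (p%:Z, q%:Z) ->
  dual_class p q t <-> exists s s', t = dual_shift f A B C l k s s'.
Proof.
move=> elk; split.
  move=> /andP[/dvdzP[s es] /dvdzP[s' es']]; exists s, s'.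
  have : dual_coord f A B C t.1 t.2 =
     dual_coord f A B C (dual_shift f A B C l k s s').1 (dual_shift f A B C l k s s').2.
    rewrite (dual_coord_shift _ D0 F) elk /= [LHS]surjective_pairing.
    by congr pair; rewrite mulrC -?es -?es' addrC subrK.
  by move=> /(dual_coord_inj D0 f0 F); case: t {es es'} => ? ?.
move=> [s [s' ->]]; rewrite /dual_class (dual_coord_shift _ D0 F) elk /=.
have addK (x y : int) : x + y - x = y by ring.
by rewrite !addK !dvdz_mulr ?dvdzz.
Qed.

(* Both the box sums defining fa and the sums over any other exhaustion of the
   lattice converge absolutely, so they have the same limit. *)
Lemma fa_lim p q S : in_dual f A B C p q -> exhausts (fun t => t != (0, 0)) S ->
  (fun M => \sum_(t <- S M) class_term p q t : (R[i])^o) @ \oo -->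
  (fa R D f A B C z p q tau : (R[i])^o).
Proof.
move=> /(in_dualP D0 f0 F)[l [k [ep eq]]] [uS eS].
have elk : dual_coord f A B C l k = (p%:Z, q%:Z) by rewrite /dual_coord -ep -eq.
have [K [r [r0 r1 hK]]] := term_bound.
pose b (t : int * int) := l1norm (kappa R D f A) * K * r ^+ (`|t.1| + `|t.2|)%N.
have K0 : 0 <= K.
  by have := hK (0, 0); rewrite expr0 mulr1; apply: le_trans; exact: l1norm_ge0.
have gb t : l1norm (class_term p q t) <= b t.
  rewrite /class_term /b; case: ifP => _.
    apply: (le_trans (l1normM _ _)); rewrite -mulrA ler_wpM2l ?hK //.
    exact: l1norm_ge0.
  by rewrite /l1norm /= normr0 addr0 !mulr_ge0 ?exprn_ge0 // l1norm_ge0.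
have [L hL] : exists L : R[i], forall S, exhausts (fun t => class_term p q t != 0) S ->
    (fun M => \sum_(t <- S M) class_term p q t : (R[i])^o) @ \oo --> (L : (R[i])^o).
  apply: (@complex_sum_cvg _ _ _ b (l1norm (kappa R D f A) * K * (2 / (1 - r)) ^+ 2)).
  - by move=> t; apply: (le_trans _ (gb t)); rewrite lerDl.
  - by move=> t; apply: (le_trans _ (gb t)); rewrite lerDr.
  move=> s us; rewrite -big_distrr /= ler_wpM2l ?mulr_ge0 ?l1norm_ge0 //.
  exact: geometric_int2_bound.
suff -> : fa R D f A B C z p q tau = L.
  apply: hL; split=> // t h; apply: eS; apply: contra_neq h => ->.
  exact: class_term0.
apply: climn_eq.
(* The boxes of [fa_ps], carried by [dual_shift] into the coordinates [(l, k)]; they exhaust the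
   coset, which supports the term. *)
pose S' M := [seq dual_shift f A B C l k st.1 st.2 | st <- zbox M].
have -> : fa_ps R D f A B C z p q tau = fun M => \sum_(t <- S' M) class_term p q t.
  apply/funext => M; rewrite big_map /zbox big_allpairs big_zrange /fa_ps.
  apply: eq_bigr => i _; rewrite big_zrange; apply: eq_bigr => j _.
  set s := i%:Z - M%:Z; set s' := j%:Z - M%:Z; set t := dual_shift _ _ _ _ _ _ _ _.
  have ec : dual_coord f A B C t.1 t.2 = (p%:Z + N%:Z * s, q%:Z + N%:Z * s').
    by rewrite (dual_coord_shift _ D0 F) elk.
  have N0 : (N%:R : R) != 0 by rewrite pnatr_eq0 -lt0n (gramN_gt0 D0 f0 F).
  have -> : p%:R / N%:R + s%:~R = (dual_coord f A B C t.1 t.2).1%:~R / N%:R :> R.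
    by rewrite ec /= intrD intrM -!pmulrn; field.
  have -> : q%:R / N%:R + s'%:~R = (dual_coord f A B C t.1 t.2).2%:~R / N%:R :> R.
    by rewrite ec /= intrD intrM -!pmulrn; field.
  rewrite (Omega'_dual D0 f0 F) (exponent_dual D0 f0 F) /class_term.
  rewrite ifT; first by rewrite -mulrA.
  by apply/(dual_classP _ elk); exists s, s'.
apply: hL; split=> [M|t].
  rewrite map_inj_uniq ?uniq_zbox // => -[s1 s2] [s3 s4].
  exact: (dual_shift_inj D0 f0 F).
rewrite /class_term; case: ifP => [/(dual_classP _ elk)[s [s' ->]] _|]; last by rewrite eqxx.
exists (maxn `|s| `|s'|) => M hM; apply/mapP; exists (s, s') => //.
by rewrite mem_zbox /=; move: hM; rewrite geq_max; lia.
Qed.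

End Tau.
End Terms.

(** * Counting ideals of given norm *)

(** The radius comes from [lnorm_bound], so the box contains every point of norm [n]. *)
Definition norm_points (A B C : int) (n : nat) : seq (int * int) :=
  [seq t <- zbox (absz (4 * (A + C)) * n) | lnorm A B C t == n%:Z].

Lemma uniq_norm_points A B C n : uniq (norm_points A B C n).
Proof. by rewrite filter_uniq // uniq_zbox. Qed.

Lemma mem_norm_points (R : realType) (D : int) (z : R[i]) A B C n t :
  D < 0 -> cm_form D z A B C ->
  (t \in norm_points A B C n) = (lnorm A B C t == n%:Z).
Proof.
move=> D0 F; rewrite mem_filter; apply: andb_idr => /eqP e.
have := lnorm_bound D0 F t; rewrite e mem_zbox PoszM gtz0_abs; last first.
  by rewrite mulr_gt0 // addr_gt0 // ?(cm_form_Agt0 F) ?(cm_form_Cgt0 D0 F).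
rewrite PoszD !abszE => h; apply/andP; split; apply: le_trans h.
  by rewrite lerDl.
by rewrite lerDr.
Qed.

Section Counting.
Variables (R : realType) (D : int) (h : nat) (z : 'I_h -> R[i]) (A B C : 'I_h -> int).
Hypotheses (D0 : D < 0) (Df : fund_disc D).
Hypothesis F : forall a, cm_form D (z a) (A a) (B a) (C a).
Hypothesis cmz : forall a, cm_by_OK R D (z a).
Hypothesis z_inj : forall a b, homothetic R (lattice R (z a)) (lattice R (z b)) -> a = b.
Hypothesis z_reps : forall w : R[i], 0 < complex.Im w -> cm_by_OK R D w ->
  exists a, homothetic R (lattice R w) (lattice R (z a)).

Definition sqr_norm (x : R[i]) : R := complex.Re x ^+ 2 + complex.Im x ^+ 2.

Lemma sqr_normM x y : sqr_norm (x * y) = sqr_norm x * sqr_norm y.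
Proof. by rewrite /sqr_norm cReM cImM; ring. Qed.

Lemma sqr_norm_eq0 x : (sqr_norm x == 0) = (x == 0).
Proof. by rewrite paddr_eq0 ?sqr_ge0 // !sqrf_eq0 eq_complex. Qed.

Lemma sqr_norm1 u : sqr_norm u = 1 -> u^-1 = conjc u.
Proof.
move=> u1; have u0 : u != 0 by rewrite -sqr_norm_eq0 u1 oner_eq0.
apply: (mulfI u0); rewrite divff //; move: u1; case: u {u0} => a b /= u1.
apply/eqP; rewrite eq_complex /=; apply/andP; split; apply/eqP.
  by rewrite -u1 /sqr_norm /=; ring.
by ring.
Qed.

Lemma lnormE a t : (lnorm (A a) (B a) (C a) t)%:~R =
  (A a)%:~R * sqr_norm (lpoint (z a) t) :> R.
Proof. exact: (sqr_norm_form D0 (F a)). Qed.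

Lemma units_seq : exists s : seq R[i], [/\ uniq s, (0 < size s)%N &
  forall u, (u \in s) <-> (OK R D u /\ sqr_norm u = 1)].
Proof.
have [Cw Fw] := cm_form_omega R Df.
pose s := [seq lpoint (omegaK R D) t | t <- norm_points 1 (- D) Cw 1].
have sP u : (u \in s) <-> (OK R D u /\ sqr_norm u = 1).
  split=> [/mapP[t]|[[l [k eu]] u1]].
    rewrite (mem_norm_points _ _ D0 Fw) => /eqP e ->.
    split; first exact: lpoint_lattice.
    have := sqr_norm_form D0 Fw t.1 t.2; rewrite -/(lnorm _ _ _ t) e mul1r => e'.
    by rewrite /sqr_norm -e'.
  apply/mapP; exists (l, k) => //; rewrite (mem_norm_points _ _ D0 Fw).
  have := sqr_norm_form D0 Fw l k; rewrite -eu mul1r => e.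
  by apply/eqP/(@intr_inj R); rewrite [LHS]e -[LHS]/(sqr_norm u) u1.
exists s; split=> //.
  rewrite map_inj_uniq ?uniq_norm_points //; exact: (lpoint_inj D0 Fw).
have : 1 \in s.
  by apply/sP; split; [exact: OK_1|rewrite /sqr_norm /= expr1n expr0n addr0].
by case: (s).
Qed.

Definition point_ideal (x : 'I_h * (int * int)) : set R[i] :=
  lattice_ideal (z x.1) (A x.1) (B x.1) (lpoint (z x.1) x.2).

Definition all_points (n : nat) : seq ('I_h * (int * int)) :=
  [seq (a, t) | a <- enum 'I_h, t <- norm_points (A a) (B a) (C a) n].

Lemma mem_all_points n x :
  (x \in all_points n) = (lnorm (A x.1) (B x.1) (C x.1) x.2 == n%:Z).
Proof.
rewrite -(mem_norm_points _ _ D0 (F x.1)); apply/allpairsPdep/idP.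
  by move=> [a [t [_ ht ->]]].
by move=> hx; exists x.1, x.2; rewrite mem_enum; split=> //; case: (x).
Qed.

Lemma uniq_all_points n : uniq (all_points n).
Proof.
apply: allpairs_uniq_dep; first exact: enum_uniq.
  by move=> a _; exact: uniq_norm_points.
by move=> [a t] [a' t'] _ _ /= [-> ->].
Qed.

Lemma all_points_neq0 n x : (0 < n)%N -> x \in all_points n ->
  lpoint (z x.1) x.2 != 0.
Proof.
move=> n0; rewrite mem_all_points => /eqP e; apply/eqP => w0.
have := lnormE x.1 x.2; rewrite e w0 /sqr_norm /= expr0n addr0 mulr0 => /eqP.
by rewrite intr_eq0 eqz_nat gt_eqF.
Qed.

(** Equal ideals have homothetic lattices, hence the same class by [z_inj]. The quotient of the two
    points then preserves the lattice, so it lies in [O_K], and equal norms give it absolute value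
    1. *)
Lemma count_point_ideal s n x0 :
  (forall u, (u \in s) <-> (OK R D u /\ sqr_norm u = 1)) -> uniq s ->
  (0 < n)%N -> x0 \in all_points n ->
  count (fun x => point_ideal x == point_ideal x0) (all_points n) = size s.
Proof.
move=> sP us n0 hx0; set w0 := lpoint (z x0.1) x0.2.
have w00 : w0 != 0 by exact: all_points_neq0 hx0.
have lw0 : lattice R (z x0.1) w0 by exact: lpoint_lattice.
set fib := [seq x <- all_points n | point_ideal x == point_ideal x0].
have fibP x : x \in fib -> x.1 = x0.1 /\
    exists2 u, u \in s & lpoint (z x0.1) x.2 = w0 * u.
  rewrite mem_filter => /andP[/eqP eI hx].
  have w1 : lpoint (z x.1) x.2 != 0 by exact: all_points_neq0 hx.
  have eh := lattice_ideal_homothetic D0 (F x0.1) (F x.1) w00 w1 (esym eI).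
  have ex : x0.1 = x.1.
    by apply: z_inj; exists (lpoint (z x.1) x.2 / w0); split=> //;
      rewrite mulf_neq0 // invr_eq0.
  split=> //; rewrite -ex in eh w1; exists (lpoint (z x0.1) x.2 / w0); last first.
    by rewrite mulrCA divff // mulr1.
  apply/sP; split.
    by rewrite -(cmz x0.1) => y ly; rewrite {1}eh; exists y.
  move: hx hx0; rewrite !mem_all_points => /eqP e1 /eqP e0.
  rewrite -ex in e1; have := lnormE x0.1 x.2; rewrite e1 -e0 lnormE -/w0.
  have A0 : ((A x0.1)%:~R : R) != 0 by rewrite intr_eq0 gt_eqF // (cm_form_Agt0 (F _)).
  move=> /(mulfI A0) e.
  have := sqr_normM (lpoint (z x0.1) x.2 / w0) w0.
  rewrite divfK // -e -{1}[sqr_norm w0]mul1r.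
  by move/mulIf => <- //; rewrite sqr_norm_eq0.
rewrite -size_filter -/fib.
rewrite -(size_map (fun x => lpoint (z x0.1) x.2)) -(size_map (fun u => w0 * u) s).
apply: perm_size; apply: uniq_perm.
- rewrite map_inj_in_uniq ?filter_uniq ?uniq_all_points // => -[a t] [a' t'].
  move=> /fibP[/= -> _] /fibP[/= -> _] /(lpoint_inj D0 (F x0.1)) ->.
  by [].
- by rewrite map_inj_uniq // => x y /(mulfI w00).
move=> v; apply/mapP/mapP => [[x /fibP[_ [u us' ->]] ->]|[u us' ->]]; first by exists u.
have [uO u1] := (sP u).1 us'.
have [l [k e]] : lattice R (z x0.1) (w0 * u).
  by rewrite mulrC; apply: (lattice_OK D0 (F x0.1)).
exists (x0.1, (l, k)); last by rewrite e.
have u0 : u != 0 by rewrite -sqr_norm_eq0 u1 oner_eq0.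
rewrite mem_filter mem_all_points /=; apply/andP; split; apply/eqP.
  have -> : point_ideal (x0.1, (l, k)) =
      lattice_ideal (z x0.1) (A x0.1) (B x0.1) (w0 * u) by rewrite e.
  apply: (lattice_ideal_unit D0 _ (F x0.1)) => //.
  by rewrite (sqr_norm1 u1); apply: conj_OK.
move: hx0; rewrite mem_all_points => /eqP e0.
apply: (@intr_inj R); rewrite lnormE /lpoint /= -e sqr_normM u1 mulr1.
by rewrite -lnormE e0.
Qed.

Lemma theta_coef_points s cf phi n :
  (forall u, (u \in s) <-> (OK R D u /\ sqr_norm u = 1)) -> uniq s -> (0 < n)%N ->
  theta_coef R D cf phi n *+ size s =
  \sum_(a < h) \sum_(t <- norm_points (A a) (B a) (C a) n)
    (if `[< coprime_id R D (point_ideal (a, t)) cf >]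
     then phi (point_ideal (a, t)) else 0).
Proof.
move=> sP us n0.
pose G (I : set R[i]) := if `[< coprime_id R D I cf >] then phi I else 0.
transitivity (\sum_(x <- all_points n) G (point_ideal x)); last first.
  by rewrite /all_points big_allpairs_dep /= big_enum.
(* Points are grouped by their ideal; each distinct ideal occurs once per unit. *)
rewrite -(big_map point_ideal xpredT G) -big_undup_iterop_count /=.
rewrite (eq_big_seq (fun I => G I *+ size s)); last first.
  move=> I; rewrite mem_undup => /mapP[x hx ->].
  rewrite count_map (count_point_ideal sP us n0 hx).
  by elim: (size s) => [|m ih] //; rewrite iteropS /= mulrS; case: m ih => [|m] /= ih; rewrite ?addr0 // ih.
suff -> : theta_coef R D cf phi n =
    \sum_(I <- undup [seq point_ideal x | x <- all_points n]) G I by rewrite sumrMnl.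
have inX I : I \in undup [seq point_ideal x | x <- all_points n] ->
    integral_ideal R D I /\ ideal_norm_is R D I n.
  rewrite mem_undup => /mapP[x hx ->]; split.
    apply: (lattice_ideal_integral D0 (F _)); first exact: lpoint_lattice.
    exact: all_points_neq0 hx.
  apply/(lattice_ideal_norm D0 _ _ n (F x.1)).
  by move: hx; rewrite mem_all_points => /eqP.
rewrite /theta_coef (fsbigE (undup [seq point_ideal x | x <- all_points n])).
- rewrite big_seq_cond [RHS]big_seq; apply: eq_bigl => I.
  apply: andb_idr => hI; apply: mem_set; exact: inX.
- exact: undup_uniq.
- by move=> I /=; exact: inX.
move=> I [iI nI]; rewrite mem_undup => /mapP hI; exfalso; apply: hI.
have [a [w [[l [k ew]] w0 eI]]] := class_representative D0 Df F z_reps iI.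
exists (a, (l, k)); last by rewrite eI ew.
rewrite mem_all_points /=; apply/eqP.
by apply/(lattice_ideal_norm D0 l k n (F a)); rewrite -ew -eI.
Qed.

End Counting.

(** * The Hecke theta function *)

Lemma cvg_sumC (R : realType) (I : Type) (r : seq I) (P : pred I)
    (u : I -> nat -> R[i]) (l : I -> R[i]) :
  (forall i, P i -> (u i : nat -> (R[i])^o) @ \oo --> (l i : (R[i])^o)) ->
  ((fun M => \sum_(i <- r | P i) u i M) : nat -> (R[i])^o) @ \oo -->
  (\sum_(i <- r | P i) l i : (R[i])^o).
Proof.
move=> ul; elim: r => [|i r ih].
  have -> : (fun M => \sum_(i <- [::] | P i) u i M) = (fun=> 0).
    by apply/funext => M; rewrite big_nil.
  by rewrite big_nil; exact: cvg_cst.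
rewrite big_cons; case: ifP => Pi.
  have -> : (fun M => \sum_(j <- i :: r | P j) u j M) =
     (fun M => u i M + \sum_(j <- r | P j) u j M).
    by apply/funext => M; rewrite big_cons Pi.
  exact: (cvgD (ul _ Pi) ih).
have -> // : (fun M => \sum_(j <- i :: r | P j) u j M) =
   (fun M => \sum_(j <- r | P j) u j M).
by apply/funext => M; rewrite big_cons Pi.
Qed.

(** Norms start at 1, as in [theta_ps]; only the origin is missed, and its term is zero. *)
Definition norm_ball (A B C : int) (M : nat) : seq (int * int) :=
  [seq t | n <- iota 1 M, t <- norm_points A B C n].

Lemma exhausts_norm_ball (R : realType) (D : int) (z : R[i]) A B C :
  D < 0 -> cm_form D z A B C ->
  exhausts (fun t => t != (0, 0)) (norm_ball A B C).
Proof.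
move=> D0 F; split=> [M|t t0].
  apply: allpairs_uniq_dep; first exact: iota_uniq.
    by move=> n _; exact: uniq_norm_points.
  move=> _ _ /allpairsPdep[n [t [_ ht ->]]] /allpairsPdep[n' [t' [_ ht' ->]]] /= e.
  move: ht ht'; rewrite !(mem_norm_points _ _ D0 F) e => /eqP -> /eqP [en].
  by rewrite en.
have := lnorm_gt0 D0 F t0; exists (absz (lnorm A B C t)) => M hM.
apply/allpairsPdep; exists (absz (lnorm A B C t)), t.
rewrite mem_iota (mem_norm_points _ _ D0 F) gtz0_abs // eqxx add1n ltnS hM.
by rewrite absz_gt0 gt_eqF.
Qed.

(** * The coefficients of one class *)

Section OneClass.
Variables (R : realType) (D : int) (f : nat) (z : R[i]) (A B C : int).
Variables (cf : set R[i]) (phi : set R[i] -> R[i]) (U : R[i]).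
Hypotheses (D0 : D < 0) (Df : fund_disc D) (f0 : (0 < f)%N).
Hypotheses (Hphi : hecke_char R D cf phi) (dvd : idvd R D cf (cbar R D f)).
Hypothesis (F : cm_form D z A B C).
Local Notation N := (gramN f A B C).
Local Notation Id := (lattice_ideal z A B).

Definition class_point (p q : nat) : R[i] :=
  Omega R f A B C z (p%:R / N%:R) (q%:R / N%:R).

(** [U] stands for the number of units; [kappa] compensates for [f_a] being built from [Omega']
    rather than [Omega]. *)
Definition theta_weight (p q : nat) : R[i] :=
  if `[< coprime_id R D (Id (class_point p q)) cf >]
  then phi (Id (class_point p q)) / class_point p q / U / kappa R D f A else 0.

Lemma in_dual_coord p q : in_dual f A B C p q ->
  exists t, dual_coord f A B C t.1 t.2 = (p%:Z, q%:Z) /\ class_point p q = lpoint z t.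
Proof.
move=> /(in_dualP D0 f0 F)[l [k [ep eq]]]; exists (l, k).
have e : dual_coord f A B C l k = (p%:Z, q%:Z) by rewrite /dual_coord -ep -eq.
split=> //; rewrite /lpoint -(Omega_dual D0 f0 F) e /=.
by rewrite /class_point.
Qed.

Lemma scaled_lattice_cong (w w' y : R[i]) : lattice R z y ->
  w' - w = f%:R * sqrtD R D * y -> lattice_cong cf z A B w w'.
Proof.
move=> ly e u iu; apply: (cbar_sub_conductor Hphi dvd).
exists (u * y); split; first exact: (inv_lattice_mul D0 F).
by rewrite e; ring.
Qed.

(** The weight is read off at one representative of the coset; it gives the right term at every [t]
    because translation by [f sqrt(D) b_z] preserves both primality to [cf] and the ratio
    [phi(I(w)) / w]. *)
Lemma theta_weight_term p q t (e : R[i]) : in_dual f A B C p q ->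
  dual_class f A B C p q t ->
  theta_weight p q * (kappa R D f A * (lpoint z t * e)) =
  (if `[< coprime_id R D (Id (lpoint z t)) cf >] then phi (Id (lpoint z t)) else 0)
  / U * e.
Proof.
move=> /in_dual_coord[t0 [et0 ew]] /(dual_classP D0 f0 F _ et0)[s [s' et]].
rewrite /theta_weight ew; set w := lpoint z t0; set w' := lpoint z t.
have lw : lattice R z w by exact: lpoint_lattice.
have lw' : lattice R z w' by exact: lpoint_lattice.
pose y := s%:~R - s'%:~R * z.
have ly : lattice R z y by exists s, (- s'); rewrite /y; ring.
have ly' : lattice R z (- y) by exists (- s), s'; rewrite /y; ring.
have ed : w' = w + f%:R * sqrtD R D * y by rewrite /w' /lpoint et (dual_shift_lattice _ D0 F).
have c1 : lattice_cong cf z A B w w'.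
  by apply: (scaled_lattice_cong ly); rewrite ed; ring.
have c2 : lattice_cong cf z A B w' w.
  by apply: (scaled_lattice_cong ly'); rewrite ed; ring.
have k0 := kappa_neq0 D0 f0 F.
case: asboolP => cw; last first.
  rewrite mul0r; case: asboolP => cw'; last by rewrite !mul0r.
  by case: cw; exact: (coprime_lattice_cong D0 Hphi F lw' lw c2 cw').
have cw' := coprime_lattice_cong D0 Hphi F lw lw' c1 cw.
have w0 := coprime_lattice_ideal_neq0 D0 Df Hphi F lw cw.
rewrite asboolT //.
have -> : phi (Id w') = phi (Id w) / w * w'.
  apply: (mulIf w0); rewrite (hecke_lattice_cong D0 Df Hphi F lw lw' c1 cw).
  by field.
(* [U] is arbitrary in this section; for [U = 0] both sides vanish since [0^-1 = 0]. *)
have [->|U0] := eqVneq U 0; first by rewrite invr0 !(mulr0, mul0r).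
by field; rewrite k0 U0 w0.
Qed.

(** Reduction modulo [N] of the numerators puts each point in exactly one coset, so a single summand
    survives. *)
Lemma dual_class_sum (g : 'I_N * 'I_N -> R[i]) t (v : R[i]) :
  exists pq : 'I_N * 'I_N, [/\ in_dual f A B C pq.1 pq.2, dual_class f A B C pq.1 pq.2 t &
  \sum_(x : 'I_N * 'I_N | in_dual f A B C x.1 x.2)
    g x * (if dual_class f A B C x.1 x.2 t then v else 0) = g pq * v].
Proof.
have N0 := gramN_gt0 D0 f0 F.
have N0Z : 0 < N%:Z by rewrite ltz_nat.
have red (P : int) : exists p : 'I_N, (N%:Z %| P - (p : nat)%:Z)%Z.
  have h1 : 0 <= (P %% N)%Z by rewrite modz_ge0 // gt_eqF.
  have h2 : (P %% N)%Z < N%:Z by rewrite ltz_pmod.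
  have h3 : (absz (P %% N)%Z < N)%N by rewrite -ltz_nat gez0_abs.
  exists (Ordinal h3); rewrite /= gez0_abs //; apply/dvdzP; exists (P %/ N)%Z.
  by rewrite {1}(divz_eq P N) addrK.
have redu (P : int) (p p' : 'I_N) : (N%:Z %| P - (p : nat)%:Z)%Z ->
    (N%:Z %| P - (p' : nat)%:Z)%Z -> p = p'.
  rewrite -!eqz_mod_dvd => /eqP e1 /eqP e2; apply: val_inj => /=.
  by have := etrans (esym e1) e2; rewrite !modz_small ?ltz_nat ?ltn_ord // => -[].
have [p hp] := red (dual_coord f A B C t.1 t.2).1.
have [q hq] := red (dual_coord f A B C t.1 t.2).2.
have dc : dual_class f A B C p q t by rewrite /dual_class hp hq.
have ind : in_dual f A B C p q.
  apply/(in_dualP D0 f0 F); move: hp hq => /dvdzP[s es] /dvdzP[s' es'].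
  (* Shifting back by the two quotients reduces the numerators to [p] and [q]. *)
  exists (dual_shift f A B C t.1 t.2 (- s) (- s')).1.
  exists (dual_shift f A B C t.1 t.2 (- s) (- s')).2.
  have := dual_coord_shift f D0 F t.1 t.2 (- s) (- s').
  rewrite {1}/dual_coord => /pair_equal_spec[-> ->].
  move/eqP: es; rewrite subr_eq => /eqP ->; move/eqP: es'; rewrite subr_eq => /eqP ->.
  by split; ring.
exists (p, q); split=> //=.
rewrite (bigD1 (p, q)) //= dc big1 ?addr0 // => -[p' q'] /= /andP[_ ne].
case: ifP => [/andP[/= hp' hq']|]; last by rewrite mulr0.
by move: ne; rewrite (redu _ _ _ hp hp') (redu _ _ _ hq hq') eqxx.
Qed.

Lemma theta_weight_sum tau t :
  \sum_(x : 'I_N * 'I_N | in_dual f A B C x.1 x.2)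
    theta_weight x.1 x.2 * class_term D f z A B C tau x.1 x.2 t =
  (if `[< coprime_id R D (Id (lpoint z t)) cf >] then phi (Id (lpoint z t)) else 0)
  / U * qexp tau (lnorm A B C t).
Proof.
have [pq [ind dc]] := dual_class_sum (fun x => theta_weight x.1 x.2) t
  (kappa R D f A * (lpoint z t * qexp tau (lnorm A B C t))).
by move=> /= e; rewrite [LHS]e theta_weight_term.
Qed.

End OneClass.

Theorem theorem3p3p10 (R : realType) (D : int) (f : nat) (h : nat)
  (z : 'I_h -> R[i]) (A B C : 'I_h -> int)
  (cf : set R[i]) (phi : set R[i] -> R[i]) :
  (* K = Q(sqrt D), D = D_K < 0 a fundamental discriminant *)
  fund_disc D -> D < 0 ->
  (* f_rho a positive integer *)
  (0 < f)%N ->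
  (* phi a Hecke character of infinity type [-1/2;1,0], conductor cf *)
  hecke_char R D cf phi ->
  (* cf divides underline c = f_rho sqrt(D_K) O_K *)
  idvd R D cf (cbar R D f) ->
  (* z_1, ..., z_h in H represent the C-isomorphism classes of elliptic
     curves C/(Z + zZ) with CM by O_K *)
  (forall a, 0 < complex.Im (z a)) ->
  (forall a, cm_by_OK R D (z a)) ->
  (forall a b, homothetic R (lattice R (z a)) (lattice R (z b)) -> a = b) ->
  (forall w : R[i], 0 < complex.Im w -> cm_by_OK R D w ->
     exists a, homothetic R (lattice R w) (lattice R (z a))) ->
  (* (a_z, b_z, c_z) : coprime integers, a_z > 0, a_z z^2 + b_z z + c_z = 0 *)
  (forall a, 0 < A a /\ gcdz (gcdz (A a) (B a)) (C a) = 1 /\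
     (A a)%:~R * z a ^+ 2 + (B a)%:~R * z a + (C a)%:~R = 0) ->
  exists coef : forall a : 'I_h,
      'I_(gramN f (A a) (B a) (C a)) * 'I_(gramN f (A a) (B a) (C a)) -> R[i],
    (forall (a : 'I_h) (pq : 'I_(gramN f (A a) (B a) (C a)) * 'I_(gramN f (A a) (B a) (C a))), in_dual f (A a) (B a) (C a) pq.1 pq.2 -> coef a pq != 0 ->
       exists Q : set R[i], integral_ideal R D Q /\ idvd R D Q (cbar R D f) /\
         coprime_id R D Q cf /\
         in_orb R D f (A a) (B a) (C a) (z a) pq.1 pq.2 Q) /\
    (forall tau : R[i], 0 < complex.Im tau ->
       theta R D cf phi tau =
       \sum_(a < h)
         \sum_(pq : 'I_(gramN f (A a) (B a) (C a)) * 'I_(gramN f (A a) (B a) (C a)) | in_dual f (A a) (B a) (C a) pq.1 pq.2)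
           coef a pq * fa R D f (A a) (B a) (C a) (z a) pq.1 pq.2 tau).
Proof.
move=> Df D0 f0 Hphi dvd zIm cmz z_inj z_reps zABC.
have F a : cm_form D (z a) (A a) (B a) (C a).
  by have [A0 [g1 e]] := zABC a; apply: cm_form_intro.
have reps I : integral_ideal R D I -> exists z A B C w,
    [/\ cm_form D z A B C, lattice R z w, w != 0 & I = lattice_ideal z A B w].
  move=> /(class_representative D0 Df F z_reps)[a [w [lw w0 eI]]].
  by exists (z a), (A a), (B a), (C a), w.
have [s [us s0 sP]] := units_seq R D0 Df.
pose U : R[i] := (size s)%:R.
have U0 : U != 0 by rewrite pnatr_eq0 -lt0n.
exists (fun a (pq : 'I_(gramN f (A a) (B a) (C a)) * 'I_(gramN f (A a) (B a) (C a))) =>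
  theta_weight D f (z a) (A a) (B a) (C a) cf phi U pq.1 pq.2).
split=> [a pq ind|tau tau0].
  rewrite /theta_weight; case: asboolP => [cw _|]; last by rewrite eqxx.
  have [t [_ ew]] := in_dual_coord D0 f0 (F a) ind.
  have lw : lattice R (z a) (class_point f (z a) (A a) (B a) (C a) pq.1 pq.2).
    by rewrite ew; exact: lpoint_lattice.
  exact: (orbit_ideal D0 Df Hphi f0 reps (F a) lw cw).
apply: climn_eq.
(* For each [M] this is an exact identity of finite sums, both running over the points of norm 1 to
   [M]; the change of order is left to [fa_lim]. *)
have -> : theta_ps R D cf phi tau = fun M => \sum_(a < h)
    \sum_(pq : 'I_(gramN f (A a) (B a) (C a)) * 'I_(gramN f (A a) (B a) (C a)) |
          in_dual f (A a) (B a) (C a) pq.1 pq.2)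
      theta_weight D f (z a) (A a) (B a) (C a) cf phi U pq.1 pq.2 *
      \sum_(t <- norm_ball (A a) (B a) (C a) M)
        class_term D f (z a) (A a) (B a) (C a) tau pq.1 pq.2 t.
  apply/funext => M; rewrite /theta_ps.
  transitivity (\sum_(a < h) \sum_(1 <= n < M.+1)
    \sum_(t <- norm_points (A a) (B a) (C a) n)
     (if `[< coprime_id R D (point_ideal z A B (a, t)) cf >]
      then phi (point_ideal z A B (a, t)) else 0) / U * qexp tau n%:Z).
    rewrite exchange_big /=; apply: eq_big_nat => n /andP[n0 _].
    have e := theta_coef_points D0 Df F cmz z_inj z_reps cf phi sP us n0.
    have -> : theta_coef R D cf phi n = theta_coef R D cf phi n *+ size s / U.
      by rewrite -mulr_natr mulfK.
    rewrite e !big_distrl /=; apply: eq_bigr => a _.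
    by rewrite !big_distrl.
  apply: eq_bigr => a _.
  under [RHS]eq_bigr do rewrite big_distrr /=.
  rewrite [RHS]exchange_big /= /norm_ball big_allpairs_dep /=.
  rewrite /index_iota subSS subn0; apply: eq_bigr => n _.
  rewrite big_seq [RHS]big_seq; apply: eq_bigr => t.
  rewrite (mem_norm_points _ _ D0 (F a)) => /eqP et.
  by rewrite (theta_weight_sum U D0 Df f0 Hphi dvd (F a)) et.
apply: cvg_sumC => a _; apply: cvg_sumC => pq ind.
apply: (@cvgMl_tmp R[i]).
exact: (fa_lim D0 f0 (F a) tau0 ind (exhausts_norm_ball D0 (F a))).
Qed.
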